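(* Let $F:\mathcal{S}_n\to\mathbb{R}$ be uniformly elliptic, continuous and quasiconcave, and let $u,v\in C(B_1)$ be viscosity subsolutions of $F(D^2w)=0$ in $B_1\subset\mathbb{R}^n$. Then for every $\theta\in(0,1)$ the function $w=\theta u+(1-\theta)v$ is a viscosity subsolution of $F(D^2w)=0$ in $B_1$.
   Context: $\mathcal{S}_n$ is the space of real symmetric $n\times n$ matrices. $F$ is uniformly elliptic with constants $0<\lambda\le\Lambda$ if $\lambda\|N\|\leq F(M+N)-F(M)\leq\Lambda\|N\|$ for all $M,N\in\mathcal{S}_n$ with $N\geq0$, where $\|N\|=\sup_{|x|=1}|Nx|$. $F$ is quasiconcave if $F(\theta M_1+(1-\theta)M_2)\geq\min\{F(M_1),F(M_2)\}$ for all $M_1,M_2\in\mathcal{S}_n$, $\theta\in[0,1]$. A continuous $u$ is a viscosity subsolution of $F(D^2u)=0$ in $\Omega$ if whenever $\varphi\in C^2(\Omega)$ and $u-\varphi$ has a local maximum at $x_0\in\Omega$, then $F(D^2\varphi(x_0))\geq0$. *)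

(* Defs.v *)
From HB Require Import structures.
From mathcomp Require Import all_boot all_order all_algebra.
From mathcomp Require Import all_classical all_reals all_analysis.
Set Implicit Arguments. Unset Strict Implicit. Unset Printing Implicit Defensive.
Import Order.TTheory GRing.Theory Num.Theory.
Import numFieldNormedType.Exports.
Local Open Scope classical_set_scope.
Local Open Scope ring_scope.

Section Defs.
Variables (R : realType) (n : nat).

Definition enorm (x : 'rV[R]_n) : R := Num.sqrt (\sum_(i < n) x ord0 i ^+ 2).

Definition opnorm (N : 'M[R]_n) : R :=
  sup [set enorm (x *m N^T) | x in [set x : 'rV[R]_n | enorm x = 1]].

Definition symmx (M : 'M[R]_n) : Prop := M^T = M.

Definition psd (N : 'M[R]_n) : Prop := forall x : 'rV[R]_n, 0 <= (x *m N *m x^T) ord0 ord0.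

Definition unif_elliptic (F : 'M[R]_n -> R) (lam Lam : R) : Prop :=
  0 < lam /\ lam <= Lam /\
  forall M N : 'M[R]_n, symmx M -> symmx N -> psd N ->
    lam * opnorm N <= F (M + N) - F M /\ F (M + N) - F M <= Lam * opnorm N.

Definition quasiconcave (F : 'M[R]_n -> R) : Prop :=
  forall (M1 M2 : 'M[R]_n) (t : R), symmx M1 -> symmx M2 -> 0 <= t <= 1 ->
    Num.min (F M1) (F M2) <= F (t *: M1 + (1 - t) *: M2).

Definition B1 : set 'rV[R]_n := [set x | enorm x < 1].

Definition evec (i : 'I_n) : 'rV[R]_n := delta_mx ord0 i.
Definition partial (i : 'I_n) (f : 'rV[R]_n -> R) : 'rV[R]_n -> R :=
  fun x => derive f x (evec i).

Definition C2_on (Omega : set 'rV[R]_n) (f : 'rV[R]_n -> R) : Prop :=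
  forall x, Omega x ->
    {for x, continuous f} /\
    forall i : 'I_n, derivable f x (evec i) /\ {for x, continuous (partial i f)} /\
      forall j : 'I_n, derivable (partial i f) x (evec j) /\
        {for x, continuous (partial j (partial i f))}.

Definition hessian (f : 'rV[R]_n -> R) (x : 'rV[R]_n) : 'M[R]_n :=
  \matrix_(i, j) partial j (partial i f) x.

Definition visc_subsol (F : 'M[R]_n -> R) (Omega : set 'rV[R]_n)
    (u : 'rV[R]_n -> R) : Prop :=
  {within Omega, continuous u} /\
  forall (phi : 'rV[R]_n -> R) (x0 : 'rV[R]_n),
    C2_on Omega phi -> Omega x0 ->
    (\forall x \near x0, u x - phi x <= u x0 - phi x0) ->
    0 <= F (hessian phi x0).

End Defs.

(* Main.v *)
Require Import Defs.
From HB Require Import structures.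
From mathcomp Require Import all_boot all_order all_algebra.
From mathcomp Require Import all_classical all_reals all_analysis.
From mathcomp Require Import ring lra.
Set Implicit Arguments. Unset Strict Implicit. Unset Printing Implicit Defensive.
Import Order.TTheory GRing.Theory Num.Theory.
Import numFieldNormedType.Exports.
Local Open Scope classical_set_scope.
Local Open Scope ring_scope.

(* Since [F] is continuous, quasiconcave and elliptic, the superlevel set [0 <= F] is a closed
   convex set of symmetric matrices which is stable under adding positive semidefinite ones.
   If [F (hessian phi z) < 0] for a test function [phi], a hyperplane separates [hessian phi z]
   from it: there are a nonzero positive semidefinite [A] and a constant [c] such that
   [\tr (A *m hessian phi z) < c <= \tr (A *m M)] whenever [0 <= F M].  So [u] and [v] are
   viscosity subsolutions of the linear equation [\tr (A *m hessian w) = c], and it remains to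
   treat a linear equation with constant coefficients.

   Choose [k] slightly below [c].  In a small ball around [z], [u] and [v] lie below polynomials
   [hu] and [hv] with [\tr (A *m hessian h) = k] that are close to [u] and [v] on the sphere: a
   continuous function is approximated by polynomials (expectations of a random walk, as for
   Bernstein polynomials), and the Dirichlet problem with polynomial data on a sphere is solved
   by a polynomial.  If [theta * u + (1 - theta) * v] is touched from above by [phi] at [z], then
   [theta * hu + (1 - theta) * hv - phi - eta * |x - z|^2] has an interior maximum, which the
   maximum principle excludes. *)

(** * Partial derivatives: chain rule, second derivative test, symmetry *)

Section DirectionalCalculus.
Context {R : realType}.

Lemma near_normP (V : normedModType R) (x : V) (P : V -> Prop) :
  (\forall y \near x, P y) <-> exists2 d, 0 < d & forall y, `|y - x| < d -> P y.
Proof.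
split=> [/nbhs_normP [d /= d0 dP]|[d d0 dP]].
  by exists d => // y yd; apply: dP; rewrite /ball_/= distrC.
by apply/nbhs_normP; exists d => //= y; rewrite /ball_/= distrC => /dP.
Qed.

(** The two difference quotients are the same function of the increment. *)
Lemma is_derive_line (V : normedModType R) (f : V -> R) (x v : V) (t : R) :
  derivable f (x + t *: v) v ->
  is_derive t 1 (fun s => f (x + s *: v)) ('D_v f (x + t *: v)).
Proof.
move=> fd; have E : (fun h : R => h^-1 *: (((fun s => f (x + s *: v)) \o shift t) (h *: 1)
   - f (x + t *: v))) =
   (fun h : R => h^-1 *: ((f \o shift (x + t *: v)) (h *: v) - f (x + t *: v))).
  apply/funext => h /=; congr (_ *: (f _ - _)).
  by rewrite scalerDl [h *: 1]mulr1 addrCA.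
by split; rewrite /derivable /derive E.
Qed.

(** Running the segment by [r] in the unit interval allows [t] of either sign. *)
Lemma mvt_line (V : normedModType R) (f : V -> R) (x v : V) (t : R) :
  (forall r : R, 0 <= r <= 1 -> derivable f (x + (t * r) *: v) v) ->
  exists2 r, 0 < r < 1 & f (x + t *: v) - f x = t * 'D_v f (x + (t * r) *: v).
Proof.
move=> fd; pose g r := f (x + (t * r) *: v).
have gd (r : R) : 0 <= r <= 1 -> is_derive r 1 g ('D_v f (x + (t * r) *: v) * t).
  move=> r01; have h : is_derive r 1 (t \*: @id R) t.
    by apply: is_derive_eq; rewrite -[t *: 1]/(t * 1) mulr1.
  apply: (@is_derive1_comp R (fun s => f (x + s *: v)) (t \*: @id R)) h.
  by apply: is_derive_line; exact: fd.
have [||r] := @MVT R g (fun r => 'D_v f (x + (t * r) *: v) * t) 0 1 ltr01.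
- by move=> r /subset_itv_oo_cc; rewrite in_itv/= => /gd.
- by apply: derivable_within_continuous => r; rewrite in_itv/= => /gd[].
- rewrite in_itv/= => r01; rewrite /g mulr0 scale0r addr0 mulr1 subr0 mulr1 mulrC.
  by exists r.
Qed.

Lemma derive_gt0_near (g : R -> R) (q : R) : is_derive (0 : R) 1 g q -> 0 < q ->
  exists2 d, 0 < d & forall s : R, 0 < s < d -> g (- s) < g 0 < g s.
Proof.
move=> [gd gE] q0.
have : \forall h \near 0^', 0 < h^-1 *: ((g \o shift 0) (h *: 1) - g 0).
  have : (h^-1 *: ((g \o shift 0) (h *: 1) - g 0) @[h --> 0^']) --> q by rewrite -gE.
  by move/cvgr_gt; apply.
rewrite near_withinE => /near_normP[d d0 dP]; exists d => // s /andP[s0 sd].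
have sN : `|s| < d by rewrite gtr0_norm.
move: (dP s) (dP (- s)); rewrite !subr0 normrN/= => /(_ sN) + /(_ sN).
rewrite oppr_eq0 gt_eqF// => /(_ isT) + /(_ isT).
rewrite !addr0 -[s *: 1]/(s * 1) -[- s *: 1]/(- s * 1) !mulr1.
rewrite -![_^-1 *: _]/(_^-1 * _) invrN mulNr -mulrN !pmulr_rgt0 ?invr_gt0//.
by lra.
Qed.

End DirectionalCalculus.

(** * Functions with continuous partial derivatives in coordinates *)

Section Partials.
Context {R : realType} {n : nat}.
Implicit Types (f g : 'rV[R]_n -> R) (x y z a : 'rV[R]_n).

Lemma mx_norm_leP z (c : R) : 0 <= c ->
  (`|z| <= c) <-> (forall j, `|z ord0 j| <= c).
Proof.
move=> c0; rewrite [`|z|]mx_normrE; split=> [/bigmax_leP[_ h] j|h].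
  exact: (h (ord0, j)).
by apply/bigmax_leP; split => // -[i j] _ /=; rewrite ord1.
Qed.

Lemma coord_le_norm z j : `|z ord0 j| <= `|z|.
Proof. exact: (mx_norm_leP _ (normr_ge0 z)).1. Qed.

(** Go from [x] to [x + z] one coordinate at a time, through the truncations [zt k] of [z], and
    apply the mean value theorem on each edge. In the maximum norm these edges stay within [|z|] of
    [x]. *)
Lemma increment_partials f x z :
  (forall y, `|y - x| <= `|z| -> forall i, derivable f y (evec R i)) ->
  exists2 w : 'I_n -> 'rV[R]_n, (forall i, `|w i| <= `|z|) &
    f (x + z) - f x = \sum_i z ord0 i * partial i f (x + w i).
Proof.
move=> fd; pose zt k : 'rV[R]_n := \row_j (if (j < k)%N then z ord0 j else 0).
have ztS (i : 'I_n) : zt i.+1 = zt i + z ord0 i *: evec R i.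
  apply/rowP => j; rewrite !mxE eqxx/= ltnS [j == i]/eq_op/=.
  by case: (ltngtP j i) => h; rewrite ?mulr0 ?addr0// mulr1 add0r; congr (z _ _); apply/val_inj.
have small (i : 'I_n) s : `|s| <= `|z ord0 i| -> `|zt i + s *: evec R i| <= `|z|.
  move=> sz; apply/mx_norm_leP => // j; rewrite !mxE eqxx/=.
  have [->|ji] := eqVneq j i; rewrite ?ltnn ?mulr1 ?mulr0 ?add0r ?addr0.
    by rewrite (le_trans sz)// coord_le_norm.
  by case: ifP => _; rewrite ?normr0// coord_le_norm.
have H (i : 'I_n) : exists w, `|w| <= `|z| /\
    f (x + zt i.+1) - f (x + zt i) = z ord0 i * partial i f (x + w).
  have zr (r : R) : 0 <= r <= 1 -> `|z ord0 i * r| <= `|z ord0 i|.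
    by move=> /andP[r0 r1]; rewrite normrM (ger0_norm r0) ler_piMr.
  have [r /zr/small h|r r01 e] := @mvt_line R _ f (x + zt i) (evec R i) (z ord0 i).
    by apply: fd; rewrite addrAC [x + _ - x]addrAC subrr add0r.
  exists (zt i + (z ord0 i * r) *: evec R i); split.
    by apply/small/zr; move: r01 => /andP[/ltW-> /ltW->].
  by rewrite ztS !addrA.
have {H}[w Hw] := choice H; exists w => [i|]; first by case: (Hw i).
have -> : z = zt n by apply/rowP => j; rewrite mxE ltn_ord.
have {2}-> : x = x + zt 0%N.
  by rewrite -[LHS]addr0; congr (_ + _); apply/rowP => j; rewrite !mxE.
rewrite -(@telescope_sumr _ 0 n (fun k => f (x + zt k)))// big_mkord.
by apply: eq_bigr => i _; rewrite (Hw i).2 mxE ltn_ord.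
Qed.

(** With [z = h *: a] in [increment_partials] the factor [h] cancels, and the partial derivatives at
    the intermediate points tend to those at [x]. *)
Lemma is_derive_partials f x a :
  (\forall y \near x, forall i, derivable f y (evec R i)) ->
  (forall i, {for x, continuous (partial i f)}) ->
  is_derive x a f (\sum_i a ord0 i * partial i f x).
Proof.
move=> /near_normP[d d0 fd] fc.
suff C : (h^-1 *: ((f \o shift x) (h *: a) - f x) @[h --> 0^']) -->
    (\sum_i a ord0 i * partial i f x).
  by split; [apply/cvg_ex; eexists; exact: C|exact: cvg_lim C].
apply/cvgrPdist_le => e e0.
have [e' e'0 e'e] : exists2 e', 0 < e' & n%:R * `|a| * e' <= e.
  (* The added 1 covers the case where [n%:R * |a|] vanishes. *)
  have na : 0 < n%:R * `|a| + 1 by rewrite ltr_wpDl// mulr_ge0.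
  exists (e / (n%:R * `|a| + 1)); first by rewrite divr_gt0.
  by rewrite mulrCA ger_pMr// ler_pdivrMr// mul1r lerDl.
have fe i : \forall y \near x, `|partial i f x - partial i f y| <= e'.
  by move: (fc i) => /cvgrPdist_le/(_ _ e'0).
have [d' d'0 fc'] := (near_normP _ _).1 (filter_forall _ fe).
rewrite near_withinE; apply: (@near_normP R R^o 0 _).2.
pose m := Num.min d d'.
have m0 : 0 < m by rewrite lt_min d0.
exists (m / (`|a| + 1)); first by rewrite divr_gt0// ltr_wpDl.
move=> h; rewrite subr0 ltr_pdivlMr ?ltr_wpDl// => hm h0.
have ham : `|h *: a| < m.
  by rewrite normrZ (le_lt_trans _ hm)// ler_wpM2l// lerDl.
have [y yx i|w wz /= e1] := @increment_partials f x (h *: a).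
  by apply: fd; apply: le_lt_trans yx (lt_le_trans ham _); rewrite ge_min lexx.
rewrite [h *: a + x]addrC e1 scaler_sumr -sumrB (le_trans (ler_norm_sum _ _ _))//.
apply: (@le_trans _ _ (\sum_(i < n) `|a| * e')).
  apply: ler_sum => i _; rewrite mxE -[_^-1 *: _]/(_^-1 * _) !mulrA mulVf// mul1r.
  rewrite -mulrBr normrM; apply: ler_pM => //; first exact: coord_le_norm.
  apply: fc'; rewrite [x + _]addrC addrK; apply: le_lt_trans (wz i) (lt_le_trans ham _).
  by rewrite ge_min lexx orbT.
by rewrite sumr_const card_ord -mulr_natl mulrA.
Qed.

Definition twice_partial f x := forall i : 'I_n, derivable f x (evec R i) /\
  {for x, continuous (partial i f)} /\
  forall j : 'I_n, derivable (partial i f) x (evec R j) /\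
    {for x, continuous (partial j (partial i f))}.

(** Let [G] be the derivative of [f] along the line through [x] in direction [a]. If the quadratic
    form were positive, [G] would lie above [G 0] just after 0 and below it just before. By
    maximality and the mean value theorem, [G] is nonpositive somewhere after 0 and nonnegative
    somewhere before, so [G 0] would be both negative and positive. *)
Lemma second_derivative_test f x a : (\forall y \near x, twice_partial f y) ->
  (\forall y \near x, f y <= f x) -> (a *m hessian f x *m a^T) ord0 ord0 <= 0.
Proof.
move=> /[dup] f2 /near_normP[d d0 fd] /near_normP[d1 d10 fmax].
have fD y : `|y - x| < d -> is_derive y a f (\sum_i a ord0 i * partial i f y).
  move=> yx; apply: is_derive_partials => [|i]; last by case: (fd _ yx i) => _ [].
  apply/near_normP; exists (d - `|y - x|); first by rewrite subr_gt0.
  move=> z zy i; suff /fd/(_ i)[] : `|z - x| < d by [].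
  by rewrite (le_lt_trans (ler_distD y _ _))// -ltrBrDr.
have pD i : is_derive x a (partial i f) (\sum_j a ord0 j * partial j (partial i f) x).
  have xx : `|x - x| < d by rewrite subrr normr0.
  apply: is_derive_partials => [|j]; last by case: (fd _ xx i) => _ [_ /(_ j)[]].
  by apply/near_normP; exists d => // y /fd/(_ i)[_ [_ h]] j; case: (h j).
set q := (X in X <= 0).
have qE : q = \sum_i a ord0 i * (\sum_j a ord0 j * partial j (partial i f) x).
  rewrite /q mxE; under eq_bigr => j _ do rewrite !mxE mulr_suml.
  rewrite exchange_big/=; apply: eq_bigr => i _; rewrite mulr_sumr.
  by apply: eq_bigr => j _; rewrite !mxE; ring.
rewrite leNgt; apply/negP => q0.
pose G t := \sum_i a ord0 i * partial i f (x + t *: a).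
have GD : is_derive (0 : R) 1 G q.
  have -> : G = \sum_i (a ord0 i \*: (fun t => partial i f (x + t *: a))).
    by apply/funext => t; rewrite fct_sumE.
  rewrite qE; apply: is_derive_sum => i; apply: is_deriveZ.
  have := @is_derive_line R _ (partial i f) x a 0; rewrite scale0r addr0 => h.
  by have [pd pv] := pD i; have := h pd; rewrite pv.
have [d2 d20 mon] := derive_gt0_near GD q0.
pose m := Num.min d2 (Num.min d d1 / (`|a| + 1)).
have a1 : 0 < `|a| + 1 by rewrite ltr_wpDl.
have m0 : 0 < m by rewrite !lt_min d20 divr_gt0// lt_min d0.
have near (t : R) : `|t| < m -> `|x + t *: a - x| < d /\ `|x + t *: a - x| < d1.
  rewrite addrAC subrr add0r lt_min => /andP[_]; rewrite ltr_pdivlMr// => h.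
  have : `|t *: a| < Num.min d d1.
    by rewrite normrZ (le_lt_trans _ h)// ler_wpM2l// lerDl.
  by rewrite lt_min => /andP.
pose t := m / 2.
have t0 : 0 < t by rewrite divr_gt0.
have tm : t < m by rewrite ltr_pdivrMr// mulr_natr mulr2n ltrDl.
have tN : `|t| = t by rewrite gtr0_norm.
have gmvt (b : R) : `|b| = t -> exists2 r, 0 < r < 1 & b * G (b * r) <= 0.
  move=> bt; have br (r : R) : 0 <= r <= 1 -> `|b * r| < m.
    by move=> /andP[r0 r1]; rewrite normrM (ger0_norm r0) (le_lt_trans _ tm)// bt ler_piMr// ltW.
  have [r /br/near[/fD[]]//|r r01 e] := @mvt_line R _ f x a b.
  have [|/fD[_ fv] _] := near (b * r).
    by apply: br; move: r01 => /andP[/ltW-> /ltW->].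
  exists r => //; rewrite /G -fv -e subr_le0; apply: fmax.
  by have [|//] := near b; rewrite bt.
have tr (r : R) : 0 < r < 1 -> 0 < t * r < d2.
  move=> /andP[r0 r1]; rewrite mulr_gt0//= (lt_trans (_ : _ < t))//.
    by rewrite gtr_pMr.
  by rewrite (lt_le_trans tm)// ge_min lexx.
have [r /tr/mon/andP[_ Gr]] := gmvt _ tN.
rewrite pmulr_rle0// => Gr0.
have [] := gmvt (- t); first by rewrite normrN.
move=> s /tr/mon/andP[Gs _]; rewrite mulNr [- t * s]mulNr oppr_le0 pmulr_rge0// => Gs0.
by lra.
Qed.

(** Two applications of the mean value theorem: to the increment [k] in direction [i], then to
    [partial i f] in direction [j]. The radius [2 * s] also covers [i = j]. *)
Lemma mixed_increment f x (i j : 'I_n) (s : R) : 0 < s ->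
  (forall y, `|y - x| <= 2 * s -> twice_partial f y) ->
  exists2 z, `|z - x| <= 2 * s &
    f (x + s *: evec R i + s *: evec R j) - f (x + s *: evec R i) -
    (f (x + s *: evec R j) - f x) = s ^+ 2 * partial j (partial i f) z.
Proof.
move=> s0 f2; pose k y := f (y + s *: evec R j) - f y.
have e1 (l : 'I_n) : `|evec R l| <= 1.
  by apply/mx_norm_leP => // l'; rewrite mxE eqxx/=; case: eqP => _; rewrite ?normr1 ?normr0.
have close (p q : R) : `|p| <= s -> `|q| <= s ->
    `|x + p *: evec R i + q *: evec R j - x| <= 2 * s.
  move=> ps qs; rewrite addrAC [x + _ - x]addrAC subrr add0r (le_trans (ler_normD _ _))//.
  by rewrite !normrZ mulr_natl mulr2n lerD// -[leRHS]mulr1 ler_pM.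
have sr (r : R) : 0 <= r <= 1 -> `|s * r| <= s.
  by move=> /andP[r0 r1]; rewrite ger0_norm ?mulr_ge0 ?ler_piMr// ltW.
have sN : `|s| <= s by rewrite gtr0_norm.
have shiftD y v : derivable f (y + s *: evec R j) v ->
    is_derive y v (fun y => f (y + s *: evec R j)) ('D_v f (y + s *: evec R j)).
  move=> fd; have E : (fun h : R => h^-1 *: (((fun y => f (y + s *: evec R j)) \o shift y) (h *: v)
     - f (y + s *: evec R j))) =
     (fun h : R => h^-1 *: ((f \o shift (y + s *: evec R j)) (h *: v) - f (y + s *: evec R j))).
    by apply/funext => h /=; rewrite addrA.
  by split; rewrite /derivable /derive E.
have kD (p : R) : `|p| <= s -> is_derive (x + p *: evec R i) (evec R i) k
    (partial i f (x + p *: evec R i + s *: evec R j) - partial i f (x + p *: evec R i)).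
  move=> ps; apply: is_deriveB.
    by apply: shiftD; have [] := f2 _ (close p s ps sN) i.
  have p0 := close p 0 ps; rewrite scale0r addr0 normr0 in p0.
  by apply: derivableP; have [] := f2 _ (p0 (ltW s0)) i.
have [r /sr/kD[]//|r /andP[/ltW r0 /ltW r1]] := @mvt_line R _ k x (evec R i) s.
have rs : `|s * r| <= s by apply: sr; rewrite r0.
have [_ ->] := kD _ rs => ek.
have [r' /sr r'1|r' /andP[/ltW r'0 /ltW r'1] ep] :=
    @mvt_line R _ (partial i f) (x + (s * r) *: evec R i) (evec R j) s.
  by have [_ [_ /(_ j)[]]] := f2 _ (close _ _ rs r'1) i.
exists (x + (s * r) *: evec R i + (s * r') *: evec R j).
  by apply: close => //; apply: sr; rewrite r'0.
by rewrite expr2 -mulrA -ep -ek.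
Qed.

(** The second difference is symmetric in [i] and [j], so the two mixed derivatives agree at two
    points arbitrarily close to [x]; continuity at [x] concludes. *)
Lemma hessian_sym f x : (\forall y \near x, twice_partial f y) ->
  (hessian f x)^T = hessian f x.
Proof.
move=> /near_normP[d d0 fd]; apply/matrixP => i j; rewrite !mxE.
apply/eqP; rewrite -subr_eq0 -normr_le0; apply/ler_addgt0Pr => e e0; rewrite add0r.
have x2 : twice_partial f x by apply: fd; rewrite subrr normr0.
have cont k l : exists2 d', 0 < d' & forall y, `|y - x| < d' ->
    `|partial k (partial l f) x - partial k (partial l f) y| <= e / 2.
  apply/near_normP; have [_ [_ /(_ k)[_]]] := x2 l.
  by move=> /cvgrPdist_le; apply; rewrite divr_gt0.
have [d1 d10 c1] := cont i j; have [d2 d20 c2] := cont j i.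
have [s s0 /and3P[sd sd1 sd2]] : exists2 s, 0 < s & [&& 2 * s < d, 2 * s < d1 & 2 * s < d2].
  have m0 : 0 < Num.min d (Num.min d1 d2) by rewrite !lt_min d0 d10.
  exists (Num.min d (Num.min d1 d2) / 4); first by rewrite divr_gt0.
  by rewrite -!lt_min; lra.
have f2 y : `|y - x| <= 2 * s -> twice_partial f y.
  by move=> h; apply: fd; exact: le_lt_trans sd.
have [z1 z1x e1] := @mixed_increment f x i j s s0 f2.
have [z2 z2x e2] := @mixed_increment f x j i s s0 f2.
have E : partial j (partial i f) z1 = partial i (partial j f) z2.
  have s2 : s ^+ 2 != 0 by rewrite expf_neq0// gt_eqF.
  apply: (mulfI s2); apply: etrans (esym e1) (etrans _ e2); rewrite [x + _ + _]addrAC.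
  move: (f (x + _ + _)) (f (x + _)) (f (x + _)) (f x) => b1 b2 b3 b4.
  by ring.
have := c1 _ (le_lt_trans z2x sd1); have := c2 _ (le_lt_trans z1x sd2).
rewrite E => h1 h2; rewrite [leRHS]splitr.
apply: le_trans (ler_distD (partial i (partial j f) z2) _ _) _.
by apply: lerD; [exact: h2|rewrite distrC; exact: h1].
Qed.

End Partials.

(** * Positive semidefinite matrices and closest points *)

Section PositiveMatrices.
Context {R : realType} {n : nat}.
Implicit Types (A H N : 'M[R]_n) (x y e : 'rV[R]_n).

Lemma quad_deltaE A i j :
  ((delta_mx ord0 i : 'rV_n) *m A *m (delta_mx ord0 j : 'rV_n)^T) ord0 ord0 = A i j.
Proof. by rewrite -rowE trmx_delta -colE !mxE. Qed.

Lemma quad_subZ A x e (s : R) :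
  ((x - s *: e) *m A *m (x - s *: e)^T) ord0 ord0 =
  (x *m A *m x^T) ord0 ord0 - s * (x *m A *m e^T) ord0 ord0
  - s * (e *m A *m x^T) ord0 ord0 + s ^+ 2 * (e *m A *m e^T) ord0 ord0.
Proof.
rewrite [(x - _)^T]raddfB/= !(mulmxBl, mulmxBr) [(s *: e)^T]linearZ/= -!scalemxAl -!scalemxAr.
move: (x *m A *m x^T) (x *m A *m e^T) (e *m A *m x^T) (e *m A *m e^T) => a b c d.
by rewrite !mxE; ring.
Qed.

Lemma psd_diag_ge0 A i : psd A -> 0 <= A i i.
Proof. by move=> /(_ (delta_mx ord0 i)); rewrite quad_deltaE. Qed.

(** Since [A i i = 0], the form at [e_j - s e_i] is affine in [s] with slope [- 2 * A i j], hence
    unbounded below unless [A i j = 0]. *)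
Lemma psd_diag0 A i j : symmx A -> psd A -> A i i = 0 -> A i j = 0.
Proof.
move=> As Ap Aii; apply/eqP; apply: contraT => Aij.
have Aji : A j i = A i j by rewrite -{1}As mxE.
(* This value of [s] makes the form equal to -1. *)
pose s := (A j j + 1) / (2 * A i j).
have := Ap (delta_mx ord0 j - s *: delta_mx ord0 i).
rewrite quad_subZ !quad_deltaE Aii Aji mulr0 addr0.
have -> : A j j - s * A i j - s * A i j = -1 by rewrite /s; field.
by rewrite lerNr oppr0 ler10.
Qed.

Lemma psd_trace_gt0 A : symmx A -> psd A -> A != 0 -> 0 < \tr A.
Proof.
move=> As Ap; apply: contraNT; rewrite -leNgt => tr0.
have A0 i : A i i = 0.
  have : \sum_i A i i == 0 by rewrite eq_le tr0 sumr_ge0// => k _; exact: psd_diag_ge0.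
  by rewrite psumr_eq0 => [/allP/(_ i)|k _]; [rewrite mem_index_enum => /(_ isT)/eqP|exact: psd_diag_ge0].
by apply/eqP/matrixP => i j; rewrite mxE psd_diag0.
Qed.

(* Cholesky elimination: subtracting a nonnegative rank-one matrix from A clears one more row. *)
Lemma psd_nsd_trace_le0 A H : symmx A -> psd A ->
  (forall x, (x *m H *m x^T) ord0 ord0 <= 0) -> \tr (A *m H) <= 0.
Proof.
move=> As Ap Hn.
(* Induction on the number [m] of leading rows that may be nonzero. *)
suff ind m B : symmx B -> psd B -> (forall i j : 'I_n, (m <= i)%N -> B i j = 0) ->
    \tr (B *m H) <= 0.
  by apply: (ind n) => // i j; rewrite leqNgt ltn_ord.
elim: m B => [|m IH] B Bs Bp B0.
  have -> : B = 0 by apply/matrixP => i j; rewrite B0// mxE.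
  by rewrite mul0mx mxtrace0.
have [mn|nm] := ltnP m n; last first.
  by apply: IH => // i j mi; move: (leq_trans nm mi); rewrite leqNgt ltn_ord.
pose k := Ordinal mn.
have Bsym i j : B i j = B j i by rewrite -{1}Bs mxE.
have [Bk|Bk] := eqVneq (B k k) 0.
  apply: IH => // i j; rewrite leq_eqVlt => /orP[/eqP mi|]; last exact: B0.
  by rewrite (_ : i = k); [exact: psd_diag0|exact/val_inj].
have Bk0 : 0 < B k k by rewrite lt_def Bk psd_diag_ge0.
pose r := row k B.
pose e : 'rV[R]_n := delta_mx ord0 k.
have rE : r = e *m B by exact: rowE.
pose C := B - (B k k)^-1 *: (r^T *m r).
have CE i j : C i j = B i j - (B k k)^-1 * (B k i * B k j).
  by rewrite !mxE big_ord1 !mxE.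
have Cs : symmx C.
  by apply/matrixP => i j; rewrite [LHS]mxE !CE Bsym; congr (_ - _ * _); exact: mulrC.
have Cp : psd C.
  (* This [s] minimizes the form of [B] at [x - s *: e], and the minimum is the form of [C] at
     [x]. *)
  move=> x; pose s := (r *m x^T) ord0 ord0 / B k k.
  have e1 : (e *m B *m x^T) ord0 ord0 = s * B k k.
    by rewrite -rE /s divfK.
  have e2 : (x *m B *m e^T) ord0 ord0 = s * B k k.
    have tE (M : 'M[R]_1) : M ord0 ord0 = M^T ord0 ord0 by rewrite mxE.
    by rewrite -e1 [LHS]tE !trmx_mul trmxK Bs mulmxA.
  have := Bp (x - s *: e); rewrite quad_subZ e1 e2 quad_deltaE.
  congr (0 <= _).
  have -> : x *m C *m x^T = x *m B *m x^T - (B k k)^-1 *: ((r *m x^T)^T *m (r *m x^T)).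
    rewrite /C mulmxBr mulmxBl -scalemxAr -scalemxAl; congr (_ - _ *: _).
    by rewrite trmx_mul trmxK !mulmxA.
  have e3 : (r *m x^T) ord0 ord0 = s * B k k by rewrite rE.
  move: (x *m B *m x^T) (r *m x^T) e3 => M N e3.
  by rewrite !mxE big_ord1 !mxE e3; field.
have -> : B = C + (B k k)^-1 *: (r^T *m r) by rewrite /C subrK.
rewrite mulmxDl mxtraceD -scalemxAl mxtraceZ -mulmxA [\tr (r^T *m _)]mxtrace_mulC trace_mx11.
rewrite -[leRHS]addr0 lerD//; last first.
  by rewrite mulr_ge0_le0// ?invr_ge0 ?ltW// Hn.
apply: IH => // i j; rewrite leq_eqVlt => /orP[/eqP mi|mi].
  have -> : i = k by exact/val_inj.
  by rewrite CE mulrA mulVf// mul1r subrr.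
by rewrite CE B0// [B k i]Bsym (B0 i k mi) mul0r mulr0 subr0.
Qed.
End PositiveMatrices.

(** * Euclidean geometry of row vectors and projection onto closed convex sets *)

Section ClosestPoint.
Context {R : realType}.

(** The ambient norm of a row vector is the maximum norm. Euclidean balls are described by [sqnorm],
    which is a polynomial, and by their squared radius. *)
Definition sqnorm n (x : 'rV[R]_n) : R := \sum_i x ord0 i ^+ 2.
Definition dotrv n (x y : 'rV[R]_n) : R := \sum_i x ord0 i * y ord0 i.

Lemma sqnorm_ge0 n (x : 'rV[R]_n) : 0 <= sqnorm x.
Proof. by apply: sumr_ge0 => i _; exact: sqr_ge0. Qed.

Lemma sqnorm_eq0 n (x : 'rV[R]_n) : sqnorm x = 0 -> x = 0.
Proof.
move=> /eqP; rewrite psumr_eq0 => [/allP h|i _]; last exact: sqr_ge0.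
apply/rowP => i; rewrite mxE; apply/eqP; rewrite -sqrf_eq0.
by apply: h; rewrite mem_index_enum.
Qed.

Lemma sqnormD n (x y : 'rV[R]_n) (t : R) :
  sqnorm (x + t *: y) = sqnorm x + 2 * t * dotrv x y + t ^+ 2 * sqnorm y.
Proof.
rewrite /sqnorm /dotrv !mulr_sumr -!big_split/=; apply: eq_bigr => i _.
by rewrite !mxE; ring.
Qed.

Lemma norm_le_sqnorm n (x : 'rV[R]_n) : `|x| ^+ 2 <= sqnorm x.
Proof.
have [->|x0] := eqVneq x 0; first by rewrite normr0 expr0n sqnorm_ge0.
have [[k j] ->] : exists ij, `|x| = `|x ij.1 ij.2|.
  by apply: mx_norm_neq0; rewrite -[mx_norm x]/(`|x|) normr_eq0.
rewrite /= ord1 real_normK ?num_real// /sqnorm (bigD1 j)//= lerDl.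
by apply: sumr_ge0 => i _; exact: sqr_ge0.
Qed.

Lemma continuous_at_sum (T : topologicalType) (I : Type) (r : seq I) (f : I -> T -> R) (x : T) :
  (forall i, {for x, continuous (f i)}) ->
  {for x, continuous (fun y => \sum_(i <- r) f i y)}.
Proof.
move=> fc; elim: r => [|i r IH].
  rewrite (_ : (fun _ => _) = cst 0); first exact: cvg_cst.
  by apply/funext => y; rewrite big_nil.
rewrite (_ : (fun _ => _) = f i \+ (fun y => \sum_(i <- r) f i y)).
  exact: (continuousD (fc i) IH).
by apply/funext => y; rewrite big_cons.
Qed.

Lemma continuous_sqnormB n (z : 'rV[R]_n) : continuous (fun x : 'rV[R]_n => sqnorm (x - z)).
Proof.
move=> x; apply: continuous_at_sum => i.
have c : {for x, continuous (fun y : 'rV[R]_n => (y - z) ord0 i)}.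
  rewrite (_ : (fun _ => _) = (fun y : 'rV[R]_n => y ord0 i) \- cst (z ord0 i)).
    by apply: continuousB; [exact: coord_continuous|exact: cst_continuous].
  by apply/funext => y; rewrite !mxE.
exact: (continuousM c c).
Qed.

Lemma compact_closed_eball n (z : 'rV[R]_n) (c : R) :
  compact [set x | sqnorm (x - z) <= c].
Proof.
apply: bounded_closed_compact; last first.
  rewrite (_ : mkset _ = (fun x => sqnorm (x - z)) @^-1` [set y | y <= c])//.
  by apply: closed_comp => [x _|]; [exact: continuous_sqnormB|exact: closed_le].
exists (`|z| + Num.sqrt c); split; first exact: num_real.
move=> m mz x /= xc; apply: le_trans (ltW mz).
rewrite -[x](subrK z) addrC (le_trans (ler_normD _ _))// lerD2l.
have c0 : 0 <= c by exact: le_trans (sqnorm_ge0 _) xc.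
rewrite -(@ler_pXn2r _ 2)// ?nnegrE ?sqrtr_ge0// sqr_sqrtr//.
exact: le_trans (norm_le_sqnorm _) xc.
Qed.

(** A nearest point [p] exists by compactness of the part of [K] in a ball. If the inner product
    were negative for some [y], a small move from [p] towards [y] would stay in [K] and come closer
    to [z]. *)
Lemma closest_point n (K : set 'rV[R]_n) (z : 'rV[R]_n) : closed K -> K !=set0 ->
  (forall x y (t : R), K x -> K y -> 0 <= t <= 1 -> K (t *: x + (1 - t) *: y)) ->
  exists2 p, K p & forall y, K y -> 0 <= dotrv (p - z) (y - p).
Proof.
move=> Kc [y0 Ky0] Kconv.
pose S := [set x | sqnorm (x - z) <= sqnorm (y0 - z)] `&` K.
have cS : compact S by apply: compact_closedI => //; exact: compact_closed_eball.
have S0 : S !=set0 by exists y0; split => //=.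
have [|p pS pmin] := @EVT_min_rV R n (fun x => sqnorm (x - z)) S S0 cS.
  by apply: continuous_subspaceT; exact: continuous_sqnormB.
move: pS; rewrite inE => -[/= pz Kp]; exists p => // y Ky.
have le x : K x -> sqnorm (p - z) <= sqnorm (x - z).
  move=> Kx; have [h|/ltW h] := leP (sqnorm (x - z)) (sqnorm (y0 - z)).
    by apply: pmin; rewrite inE; split.
  exact: le_trans pz h.
rewrite leNgt; apply/negP => D0.
pose D := dotrv (p - z) (y - p); pose S' := sqnorm (y - p).
have S'0 : 0 <= S' by exact: sqnorm_ge0.
have SD : 0 < S' - D by rewrite /D; lra.
(* Then [t * S' = t * D - D], so [2 * D + t * S' = (1 + t) * D < 0], and [t <= 1] because [S'] is
   nonnegative. *)
pose t := - D / (S' - D).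
have t0 : 0 < t by rewrite divr_gt0// oppr_gt0.
have t1 : t <= 1 by rewrite ler_pdivrMr// mul1r lerDr.
have := le (t *: y + (1 - t) *: p) (Kconv _ _ _ Ky Kp _).
rewrite t1 (ltW t0) => /(_ isT).
have -> : t *: y + (1 - t) *: p - z = p - z + t *: (y - p).
  by apply/rowP => i; rewrite !mxE; ring.
rewrite sqnormD -/D -/S' -addrA lerDl.
have -> : 2 * t * D + t ^+ 2 * S' = t * (2 * D + t * S') by ring.
rewrite pmulr_rge0// => h.
have : t * (S' - D) = - D by rewrite /t divfK// gt_eqF.
by have := mulr_gt0 t0 SD; move: D0; rewrite -/D; nra.
Qed.
End ClosestPoint.

(** * Separation *)

Section Separation.
Context {R : realType} {n : nat}.
Implicit Types (A M N : 'M[R]_n) (K : set 'M[R]_n).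

Lemma dotrv_mxvec A M : symmx A -> dotrv (mxvec A) (mxvec M) = \tr (A *m M).
Proof.
move=> As; rewrite /dotrv (reindex _ (curry_mxvec_bij n n))/=.
rewrite /mxtrace; under [RHS]eq_bigr => i _ do rewrite mxE.
rewrite exchange_big pair_big/=; apply: eq_bigr => -[i j] _ /=.
by rewrite !mxvecE -{1}As mxE.
Qed.

Lemma continuous_vec_mx : continuous (@vec_mx R n n).
Proof.
move=> v s /nbhs_ballP[e e0 es]; apply/nbhs_ballP; exists e => // w [_ vw].
by apply: es; split => // i j; rewrite !mxE; exact: vw.
Qed.

(** Take [A = M1 - M0] with [M1] the point of [K] nearest to [M0] for the trace inner product.
    Comparing [M1] with [M1 + x^T *m x], which is again in [K], shows that the form of [A] at [x] is
    nonnegative. *)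
Lemma psd_separation K M0 : (0 < n)%N -> closed K -> (forall M, K M -> symmx M) ->
  (forall M N (t : R), K M -> K N -> 0 <= t <= 1 -> K (t *: M + (1 - t) *: N)) ->
  (forall M N, K M -> symmx N -> psd N -> K (M + N)) ->
  symmx M0 -> ~ K M0 ->
  exists A (c : R), [/\ symmx A, psd A, 0 < \tr A,
    forall M, K M -> c <= \tr (A *m M) & \tr (A *m M0) < c].
Proof.
move=> n0 Kcl Ks Kconv Kup M0s KM0.
have psdx (x : 'rV[R]_n) : symmx (x^T *m x) /\ psd (x^T *m x).
  split=> [|y]; first by rewrite /symmx trmx_mul trmxK.
  have -> : y *m (x^T *m x) *m y^T = (x *m y^T)^T *m (x *m y^T).
    by rewrite trmx_mul trmxK !mulmxA.
  by move: (x *m y^T) => m; rewrite mxE big_ord1 mxE -expr2 sqr_ge0.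
(* If [K] is empty, the identity matrix and any constant above [\tr M0] will do. *)
have [[M KM]|Kempty] := pselect (K !=set0); last first.
  exists 1%:M, (\tr (1%:M *m M0) + 1); split.
  - exact: trmx1.
  - move=> x; rewrite mulmx1 mxE sumr_ge0// => i _.
    by rewrite mxE -expr2 sqr_ge0.
  - by rewrite mxtrace1 ltr0n.
  - by move=> M KM; case: Kempty; exists M.
  - by rewrite ltrDl.
have [|||p Kp pmin] := @closest_point R _ (vec_mx @^-1` K) (mxvec M0).
- by apply: preimage_closed => // v _; exact: continuous_vec_mx.
- by exists (mxvec M); rewrite /= mxvecK.
- by move=> x y t Kx Ky t01; rewrite /= linearD/= !linearZ/=; exact: Kconv.
have {}Kp : K (vec_mx p) by [].
set M1 := vec_mx p in Kp; pose A := M1 - M0.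
have M1s := Ks _ Kp.
have As : symmx A by rewrite /symmx /A raddfB/= M1s M0s.
have Amin N : K N -> 0 <= \tr (A *m (N - M1)).
  move=> KN; rewrite -dotrv_mxvec// !raddfB/= vec_mxK.
  by apply: pmin; rewrite /= mxvecK.
have A0 : A != 0.
  by apply/negP; rewrite subr_eq0 => /eqP E; apply: KM0; rewrite -E.
have Ap : psd A.
  move=> x; have [xs xp] := psdx x.
  have := Amin _ (Kup _ _ Kp xs xp).
  by rewrite addrC addKr mulmxA mxtrace_mulC mulmxA trace_mx11.
exists A, (\tr (A *m M1)); split => //.
- exact: psd_trace_gt0.
- by move=> N /Amin; rewrite mulmxBr raddfB/= subr_ge0.
- rewrite -subr_gt0 -raddfB/= -mulmxBr -/A -dotrv_mxvec//.
  have -> : dotrv (mxvec A) (mxvec A) = sqnorm (mxvec A).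
    by apply: eq_bigr => i _; rewrite expr2.
  rewrite lt_def sqnorm_ge0 andbT; apply: contra A0 => /eqP/sqnorm_eq0 E.
  by rewrite -(mxvecK A) E linear0.
Qed.

Lemma opnorm_ge0 N : 0 <= opnorm N.
Proof.
have [h|h] := pselect (has_sup [set enorm (x *m N^T) | x in [set x | enorm x = 1]]).
  have [[y Sy] ub] := h; apply: le_trans (ub_le_sup ub Sy).
  by case: Sy => x _ <-; exact: sqrtr_ge0.
(* A set without supremum has [sup] equal to 0. *)
by rewrite /opnorm sup_out.
Qed.

(** Continuity of [F] is known only relative to the symmetric matrices, so the limit matrix is first
    shown to be symmetric. *)
Lemma superlevel_closed (F : 'M[R]_n -> R) :
  {within [set M | symmx M], continuous F} -> closed [set M | symmx M /\ 0 <= F M].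
Proof.
move=> /subspace_continuousP Fc M Mcl.
have Ms : symmx M.
  apply/matrixP => i j; rewrite mxE; apply/eqP; rewrite -subr_eq0; apply/eqP.
  pose g (N : 'M[R]_n) : R := N j i - N i j.
  have gcl : closed (g @^-1` [set 0]).
    apply: preimage_closed; last exact: closed_eq.
    by move=> N _; apply: continuousB; exact: coord_continuous.
  apply: gcl; apply: closure_subset Mcl => N [Ns _] /=.
  by rewrite /g -{1}Ns mxE subrr.
split => //; rewrite leNgt; apply/negP => FM.
have : \forall N \near within [set M | symmx M] (nbhs M), F N < 0.
  by move: (Fc _ Ms) => /cvgr_lt; apply.
rewrite near_withinE => /Mcl[N [[Ns FN] /(_ Ns)]].
by rewrite ltNge FN.
Qed.

(** Quasiconcavity makes the superlevel set convex, and the lower ellipticity bound makes it stable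
    under adding positive semidefinite matrices. *)
Lemma elliptic_separation (F : 'M[R]_n -> R) (lam Lam : R) M0 : (0 < n)%N ->
  unif_elliptic F lam Lam -> {within [set M | symmx M], continuous F} ->
  quasiconcave F -> symmx M0 -> F M0 < 0 ->
  exists A (c : R), [/\ symmx A, psd A, 0 < \tr A,
    forall M, symmx M -> 0 <= F M -> c <= \tr (A *m M) & \tr (A *m M0) < c].
Proof.
move=> n0 [lam0 [_ Fell]] Fc Fq M0s FM0.
have [|||||A [c [As Ap At Ac AM]]] :=
  @psd_separation [set M | symmx M /\ 0 <= F M] M0 n0 (superlevel_closed Fc).
- by move=> M [].
- move=> M N t [Ms FM] [Ns FN] t01; split.
    by rewrite /symmx linearD/= !linearZ/= Ms Ns.
  by apply: le_trans (Fq _ _ _ Ms Ns t01); rewrite le_min FM.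
- move=> M N [Ms FM] Ns Np; split; first by rewrite /symmx linearD/= Ms Ns.
  have [h _] := Fell M N Ms Ns Np.
  have := le_trans (mulr_ge0 (ltW lam0) (opnorm_ge0 N)) h.
  by rewrite subr_ge0; exact: le_trans.
- exact: M0s.
- by move=> [_]; rewrite leNgt FM0.
by exists A, c; split => // M Ms FM; exact: Ac.
Qed.
End Separation.

(** * Polynomial functions *)

(* Among [g], [T g], [T (T g)], ... there is a linear relation; cancelling [T] by
   injectivity until its constant coefficient is nonzero exhibits [g] as a value of [T]. *)
Lemma fin_span_inj_surj (K : fieldType) (V : lmodType K) (P : V -> Prop) (I : finType)
    (m : I -> V) (T : V -> V) :
  (forall f, P f -> exists a : I -> K, f = \sum_k a k *: m k) ->
  P 0 -> (forall a f g, P f -> P g -> P (a *: f + g)) -> (forall f, P f -> P (T f)) ->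
  (forall a f g, P f -> P g -> T (a *: f + g) = a *: T f + T g) ->
  (forall f, P f -> T f = 0 -> f = 0) ->
  forall g, P g -> exists2 f, P f & T f = g.
Proof.
move=> Psp P0 Plin PT Tlin Tinj g Pg.
have T0 : T 0 = 0 by have := Tlin (-1) _ _ P0 P0; rewrite scaler0 addr0 scaleN1r addNr.
have Piter k : P (iter k T g) by elim: k => //= k; exact: PT.
have Psum N (a : nat -> K) (f : nat -> V) : (forall k, P (f k)) ->
    P (\sum_(k < N) a k *: f k) /\
    T (\sum_(k < N) a k *: f k) = \sum_(k < N) a k *: T (f k).
  move=> Pf; elim: N => [|N [IP IT]]; first by rewrite !big_ord0.
  by rewrite !big_ord_recr/= addrC; split; [exact: Plin|rewrite Tlin// IT addrC].
have red N (a : nat -> K) : (exists2 k, (k < N)%N & a k != 0) ->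
    \sum_(k < N) a k *: iter k T g = 0 -> exists2 f, P f & T f = g.
  elim: N a => [|N IH] a [k kN ak]; first by [].
  rewrite big_ord_recl/=.
  have [Ps <-] := Psum N (fun k => a k.+1) (fun k => iter k T g) Piter.
  have [a0|a0] := eqVneq (a 0%N) 0; last first.
    move=> /eqP; rewrite addrC addr_eq0 => /eqP E.
    exists (- (a 0%N)^-1 *: (\sum_(k < N) a k.+1 *: iter k T g)).
      by have := Plin (- (a 0%N)^-1) _ _ Ps P0; rewrite addr0.
    have := Tlin (- (a 0%N)^-1) _ _ Ps P0; rewrite T0 !addr0 => ->.
    by rewrite E scaleNr scalerN opprK scalerA mulVf// scale1r.
  rewrite a0 scale0r add0r => /(Tinj _ Ps); apply: (IH (fun k => a k.+1)).
  by case: k kN ak => [|k] kN ak; [rewrite a0 eqxx in ak|exists k].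
have [B BE] := choice (fun k => Psp _ (Piter k)).
(* Coordinates of the first [#|I|.+1] iterates: with more rows than columns, [M] has a nonzero left
   kernel, which is the desired linear relation. *)
pose M : 'M[K]_(#|I|.+1, #|I|) := \matrix_(k, l) B k (enum_val l).
have : kermx M != 0.
  by rewrite -mxrank_eq0 mxrank_ker subn_eq0 -ltnNge ltnS rank_leq_col.
move=> /rowV0Pn[v /sub_kermxP vM v0].
apply: (red #|I|.+1 (fun k => v ord0 (inord k))).
  have [k vk] : exists k, v ord0 k != 0.
    apply/existsP; apply: contraNT v0; rewrite negb_exists => /forallP h.
    by apply/eqP/rowP => k; rewrite mxE; apply/eqP; rewrite -[_ == _]negbK.
  by exists k => //; rewrite inord_val.
under eq_bigr => k _ do rewrite inord_val BE scaler_sumr.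
rewrite exchange_big big1// => l _ /=.
under eq_bigr => k _ do rewrite scalerA.
rewrite -scaler_suml; have := congr1 (fun A : 'rV__ => A ord0 (enum_rank l)) vM.
rewrite !mxE => E; rewrite [X in X *: _](_ : _ = 0) ?scale0r// -[RHS]E.
by apply: eq_bigr => k _; rewrite mxE enum_rankK.
Qed.

Section PolynomialFunctions.
Context {R : realType} {n : nat}.
Implicit Types (f g : 'rV[R]_n -> R) (x y z : 'rV[R]_n).

(** Polynomial functions of degree at most [d]. Splitting off one coordinate factor at a time turns
    their properties into inductions on [d]. *)
Fixpoint polyfun d f : Prop :=
  if d is d'.+1 then
    exists g0 (g : 'I_n -> 'rV[R]_n -> R),
      [/\ polyfun d' g0, forall i, polyfun d' (g i) &
          f = fun x => g0 x + \sum_i x ord0 i * g i x]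
  else exists c, f = cst c.

Lemma polyfun_cst d c : polyfun d (cst c).
Proof.
elim: d c => [|d IH] c; first by exists c.
exists (cst c), (fun=> cst 0); split => //; apply/funext => x.
by rewrite big1 ?addr0// => i _; rewrite mulr0.
Qed.

Lemma polyfun_lin d (a : R) f g : polyfun d f -> polyfun d g ->
  polyfun d (fun x => a * f x + g x).
Proof.
elim: d f g => [|d IH] f g; first by move=> [c ->] [c' ->]; exists (a * c + c').
move=> [f0 [fi [Pf0 Pfi ->]]] [g0 [gi [Pg0 Pgi ->]]].
exists (fun x => a * f0 x + g0 x), (fun i x => a * fi i x + gi i x).
split=> [|i|]; [exact: IH|exact: (IH _ _ (Pfi i) (Pgi i))|apply/funext => x].
rewrite mulrDr addrACA mulr_sumr -big_split/=; congr (_ + _).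
by apply: eq_bigr => i _; ring.
Qed.

Lemma polyfunZ d (a : R) f : polyfun d f -> polyfun d (fun x => a * f x).
Proof.
move=> Pf; have := polyfun_lin a Pf (polyfun_cst d 0).
by congr (polyfun _ _); apply/funext => x; rewrite addr0.
Qed.

Lemma polyfunD d f g : polyfun d f -> polyfun d g -> polyfun d (fun x => f x + g x).
Proof.
move=> Pf Pg; have := polyfun_lin 1 Pf Pg.
by congr (polyfun _ _); apply/funext => x; rewrite mul1r.
Qed.

Lemma polyfun_sum d (I : Type) (r : seq I) (f : I -> 'rV[R]_n -> R) :
  (forall i, polyfun d (f i)) -> polyfun d (fun x => \sum_(i <- r) f i x).
Proof.
move=> Pf; elim: r => [|i r IH].
  by have := polyfun_cst d 0; congr polyfun; apply/funext => x; rewrite big_nil.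
by have := polyfunD (Pf i) IH; congr polyfun; apply/funext => x; rewrite big_cons.
Qed.

Lemma polyfunS d f : polyfun d f -> polyfun d.+1 f.
Proof.
move=> Pf; exists f, (fun=> cst 0); split => // [i|]; first exact: polyfun_cst.
by apply/funext => x; rewrite big1 ?addr0// => i _; rewrite mulr0.
Qed.

Lemma polyfun_le d d' f : (d <= d')%N -> polyfun d f -> polyfun d' f.
Proof. by move=> /subnK <-; elim: (d' - d)%N => //= k IH /IH; exact: polyfunS. Qed.

Lemma polyfun_coordM d f i : polyfun d f -> polyfun d.+1 (fun x => x ord0 i * f x).
Proof.
move=> Pf; exists (cst 0), (fun j => if j == i then f else cst 0); split.
- exact: polyfun_cst.
- by move=> j; case: eqP => _ //; exact: polyfun_cst.
- apply/funext => x; rewrite add0r (bigD1 i)//= eqxx big1 ?addr0// => j /negbTE ->.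
  by rewrite mulr0.
Qed.

Lemma polyfun_continuous d f : polyfun d f -> continuous f.
Proof.
elim: d f => [|d IH] f; first by move=> [c ->]; exact: cst_continuous.
move=> [g0 [g [P0 Pg ->]]] x.
apply: (@continuousD _ _ _ g0 (fun x => \sum_i x ord0 i * g i x)); first exact: IH.
apply: continuous_at_sum => i.
apply: (@continuousM _ _ (fun x : 'rV[R]_n => x ord0 i) (g i)).
  exact: coord_continuous.
exact: (IH _ (Pg i)).
Qed.

Lemma is_derive_coord x (i j : 'I_n) :
  is_derive x (evec R j) (fun y : 'rV[R]_n => y ord0 i) (i == j)%:R.
Proof.
have C : (h^-1 *: (((fun y : 'rV[R]_n => y ord0 i) \o shift x) (h *: evec R j) - x ord0 i)
    @[h --> 0^']) --> ((i == j)%:R : R).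
  apply: cvg_near_cst; near=> h.
  rewrite /= !mxE addrK eqxx/= eq_sym -[_ *: _]/(_ * _) mulrA mulVf ?mul1r//.
  by near: h; exact: nbhs_dnbhs_neq.
by split; [apply/cvg_ex; eexists; exact: C|exact: cvg_lim C].
Unshelve. all: end_near. Qed.

(** The last clause serves the induction: in the passage from degree 0 to 1, the products
    [x_j * partial i (g j)] must have degree 0, which holds because they vanish. *)
Lemma polyfun_partial d f i : polyfun d f ->
  [/\ forall x, derivable f x (evec R i), polyfun d.-1 (partial i f) &
      d = 0%N -> partial i f = cst 0].
Proof.
elim: d f => [|d IH] f.
  move=> [c ->]; have E : partial i (cst c) = cst 0.
    by apply/funext => x; exact: derive_cst.
  by split => [x||//]; [exact: derivable_cst|rewrite E; exact: polyfun_cst].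
move=> [g0 [g [P0 Pg ->]]].
set h := (X in derivable X).
have hD x : is_derive x (evec R i) h
   (partial i g0 x + (g i x + \sum_j x ord0 j * partial i (g j) x)).
  have [d0 _ _] := IH _ P0.
  have -> : h = g0 + \sum_j ((fun y : 'rV[R]_n => y ord0 j) * g j).
    by apply/funext => y; apply: (congr1 (fun s => g0 y + s)); rewrite fct_sumE.
  apply: is_deriveD; first exact: derivableP.
  have -> : g i x + \sum_j x ord0 j * partial i (g j) x =
      \sum_j (x ord0 j *: partial i (g j) x + g j x *: (j == i)%:R).
    rewrite big_split/= addrC; congr (_ + _).
    rewrite (bigD1 i)//= eqxx big1 ?addr0 => [|j /negbTE ->]; last exact: mulr0.
    by rewrite -[_ *: _]/(_ * _) mulr1.
  apply: is_derive_sum => j; apply: is_deriveM; first exact: is_derive_coord.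
  by apply: derivableP; have [] := IH _ (Pg j).
have hE : partial i h = fun x => partial i g0 x + (g i x + \sum_j x ord0 j * partial i (g j) x).
  by apply/funext => x; have [_] := hD x.
split => [x||//]; first by have [] := hD x.
rewrite hE; apply: (@polyfunD d (partial i g0)).
  by have [_ + _] := IH _ P0; apply: polyfun_le; exact: leq_pred.
apply: (@polyfunD d (g i)); first exact: Pg.
apply: (@polyfun_sum d _ _ (fun j x => x ord0 j * partial i (g j) x)) => j.
have [_ + c0] := IH _ (Pg j); case: d c0 {IH P0 Pg} => [/(_ erefl) -> _|d _].
  by have := polyfun_cst 0 0; congr polyfun; apply/funext => x; rewrite mulr0.
exact: polyfun_coordM.
Qed.

Lemma polyfun_C2 d f (Omega : set 'rV[R]_n) : polyfun d f -> C2_on Omega f.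
Proof.
move=> Pf x _; split; first exact: (polyfun_continuous Pf).
move=> i; have [fd Pfi _] := polyfun_partial i Pf.
split; first exact: fd.
split; first exact: (polyfun_continuous Pfi).
move=> j; have [fdj Pfij _] := polyfun_partial j Pfi.
by split; [exact: fdj|exact: (polyfun_continuous Pfij)].
Qed.

(** The family consists of monomials, possibly with repetitions, so it spans without being a
    basis. *)
Lemma polyfun_span d : exists (I : finType) (m : I -> 'rV[R]_n -> R),
  forall f, polyfun d f -> exists a : I -> R, f = \sum_k a k *: m k.
Proof.
elim: d => [|d [I [m IH]]].
  exists unit, (fun=> cst 1) => f [c ->]; exists (fun=> c).
  rewrite (bigD1 tt)//= big1 ?addr0 => [|[]//].
  by apply/funext => x; rewrite -[RHS]/(c * 1) mulr1.
exists (I + 'I_n * I)%type,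
  (fun k => match k with inl k => m k | inr (i, k) => fun x => x ord0 i * m k x end).
move=> f [g0 [g [/IH[a ga] Pg ->]]].
have [b gb] := choice (fun i => IH _ (Pg i)).
exists (fun k => match k with inl k => a k | inr (i, k) => b i k end).
rewrite big_sumType/= ga; apply/funext => x.
apply: (congr1 (fun s => (\sum_k a k *: m k) x + s)).
under eq_bigr => i _ do rewrite gb fct_sumE mulr_sumr.
rewrite fct_sumE pair_big/=; apply: eq_bigr => -[i k] _ /=.
by rewrite -[LHS]/(x ord0 i * (b i k * m k x)) mulrCA.
Qed.

Lemma polyfun_line d f x y : polyfun d f ->
  exists Q : {poly R}, forall t, f (x + t *: y) = Q.[t].
Proof.
elim: d f => [|d IH] f; first by move=> [c ->]; exists c%:P => t; rewrite hornerC.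
move=> [g0 [g [/IH[Q0 Q0E] Pg ->]]].
have [Q QE] := choice (fun i => IH _ (Pg i)).
exists (Q0 + \sum_i ((x ord0 i)%:P + y ord0 i *: 'X) * Q i) => t.
rewrite hornerD horner_sum Q0E; congr (_ + _); apply: eq_bigr => i _.
by rewrite !hornerE QE !mxE [t * _]mulrC.
Qed.

(** On the line through [z] and [x] the function is a polynomial in one variable that vanishes near
    0, hence everywhere. *)
Lemma polyfun_identity d f z (c : R) : 0 < c -> polyfun d f ->
  (forall x, sqnorm (x - z) < c -> f x = 0) -> forall x, f x = 0.
Proof.
move=> c0 Pf f0 x; have [Q QE] := polyfun_line z (x - z) Pf.
have S0 := sqnorm_ge0 (x - z); set S := sqnorm (x - z) in S0.
have cS : 0 < c + S + 1 by lra.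
(* Chosen so that [e <= 1] and [e * S < c]: for [0 < t <= e] the point at parameter [t] then has
   squared distance [t ^+ 2 * S < c] from [z]. *)
pose e := c / (c + S + 1).
have e0 : 0 < e by rewrite divr_gt0.
have e1 : e <= 1 by rewrite ler_pdivrMr// mul1r; lra.
have eS : e * S < c by rewrite mulrAC ltr_pdivrMr// ltr_pM2l//; lra.
suff Q0 : Q = 0 by have := QE 1; rewrite Q0 horner0 scale1r addrC subrK.
apply/eqP; apply: contraT => Q0.
(* As many distinct roots as the size of [Q], one more than its degree permits. *)
pose rs := [seq e / k.+1%:R | k <- iota 0 (size Q)].
suff : (size rs < size Q)%N by rewrite size_map size_iota ltnn.
apply: max_poly_roots => //.
  apply/allP => _ /mapP[k _ ->]; rewrite /root -QE f0//.
  have k1 : 1 <= k.+1%:R :> R by rewrite ler1n.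
  have t0 : 0 < e / k.+1%:R by rewrite divr_gt0.
  have te : e / k.+1%:R <= e by rewrite ler_pdivrMr// ler_peMr// ltW.
  rewrite addrC addKr -[_ *: _]add0r sqnormD; move: (e / _) t0 te => t t0 te.
  have -> : sqnorm (0 : 'rV[R]_n) = 0 by apply: big1 => i _; rewrite mxE expr0n.
  have -> : dotrv 0 (x - z) = 0 by apply: big1 => i _; rewrite mxE mul0r.
  rewrite mulr0 !add0r -/S; apply: le_lt_trans eS.
  rewrite ler_wpM2r// expr2 (le_trans _ te)// ler_piMr ?(ltW t0)//.
  exact: le_trans te e1.
rewrite map_inj_uniq ?iota_uniq// => k l /(mulfI (lt0r_neq0 e0))/invr_inj/eqP.
by rewrite eqr_nat => /eqP[].
Qed.

End PolynomialFunctions.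

(** * Maximum principle and polynomial Dirichlet problem *)

Section Hessians.
Context {R : realType} {n : nat}.
Implicit Types (f g h : 'rV[R]_n -> R) (x y z : 'rV[R]_n) (Omega : set 'rV[R]_n).

Lemma near_eq_continuous_at f g x : (\forall y \near x, f y = g y) ->
  {for x, continuous f} -> {for x, continuous g}.
Proof.
move=> fg fc; rewrite /prop_for /continuous_at -(nbhs_singleton fg).
exact: cvg_trans (near_eq_cvg fg) fc.
Qed.

Lemma near_open Omega x : open Omega -> Omega x -> \forall y \near x, Omega y.
Proof. by move=> Oo Ox; exact: open_nbhs_nbhs. Qed.

Lemma partial_lin Omega (a : R) f g h i : open Omega ->
  (forall y, Omega y -> h y = a * f y + g y) ->
  (forall y, Omega y -> derivable f y (evec R i)) ->
  (forall y, Omega y -> derivable g y (evec R i)) ->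
  forall y, Omega y -> is_derive y (evec R i) h (a * partial i f y + partial i g y).
Proof.
move=> Oo hE fd gd y Oy.
apply: (@near_eq_is_derive _ _ _ (a \*: f + g)).
  by apply: filterS (near_open Oo Oy) => z Oz; rewrite hE.
by apply: is_deriveD; first apply: is_deriveZ; apply: derivableP; [exact: fd|exact: gd].
Qed.

Lemma continuous_lin Omega (a : R) f g h x : open Omega -> Omega x ->
  (forall y, Omega y -> h y = a * f y + g y) ->
  {for x, continuous f} -> {for x, continuous g} -> {for x, continuous h}.
Proof.
move=> Oo Ox hE fc gc; apply: (@near_eq_continuous_at (cst a * f + g)).
  by apply: filterS (near_open Oo Ox) => y Oy; rewrite hE.
by apply: continuousD => //; apply: continuousM => //; exact: cst_continuous.
Qed.

(** The shape [a * f + g] covers sums, differences and multiples at once. Openness of [Omega] lets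
    the formula for first derivatives be differentiated again. *)
Lemma C2_lin Omega (a : R) f g : open Omega -> C2_on Omega f -> C2_on Omega g ->
  C2_on Omega (fun x => a * f x + g x) /\
  forall x, Omega x ->
    hessian (fun x => a * f x + g x) x = a *: hessian f x + hessian g x.
Proof.
move=> Oo f2 g2; set h := fun x => _.
have fD1 i y : Omega y -> derivable f y (evec R i) by move=> /f2[_ /(_ i)[]].
have gD1 i y : Omega y -> derivable g y (evec R i) by move=> /g2[_ /(_ i)[]].
have fD2 i j y : Omega y -> derivable (partial i f) y (evec R j).
  by move=> /f2[_ /(_ i)[_ [_ /(_ j)[]]]].
have gD2 i j y : Omega y -> derivable (partial i g) y (evec R j).
  by move=> /g2[_ /(_ i)[_ [_ /(_ j)[]]]].
have h1 i y : Omega y -> is_derive y (evec R i) h (a * partial i f y + partial i g y).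
  by apply: partial_lin; [exact: Oo|by []|exact: fD1|exact: gD1].
have p1 i y : Omega y -> partial i h y = a * partial i f y + partial i g y.
  by move=> /(h1 i)[].
have h2 i j y : Omega y -> is_derive y (evec R j) (partial i h)
    (a * partial j (partial i f) y + partial j (partial i g) y).
  by apply: partial_lin; [exact: Oo|exact: p1|exact: fD2|exact: gD2].
have p2 i j y : Omega y ->
    partial j (partial i h) y = a * partial j (partial i f) y + partial j (partial i g) y.
  by move=> /(h2 i j)[].
split=> x Ox; last first.
  have HE k i j : hessian k x i j = partial j (partial i k) x by rewrite mxE.
  have linE (M N : 'M[R]_n) i j : (a *: M + N) i j = a * M i j + N i j by rewrite !mxE.
  apply/matrixP => i j; rewrite linE; apply: etrans (HE h i j) (etrans (p2 i j x Ox) _).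
  exact/esym/(congr2 (fun s t => a * s + t) (HE f i j) (HE g i j)).
have [fc fi] := f2 _ Ox; have [gc gi] := g2 _ Ox.
split; first exact: (@continuous_lin Omega a f g).
move=> i; have [_ [fic fij]] := fi i; have [_ [gic gij]] := gi i.
split; first by have [] := h1 i _ Ox.
split; first exact: (continuous_lin Oo Ox (p1 i) fic gic).
move=> j; have [_ fijc] := fij j; have [_ gijc] := gij j.
split; first by have [] := h2 i j _ Ox.
exact: (continuous_lin Oo Ox (p2 i j) fijc gijc).
Qed.

Lemma C2_near_twice_partial Omega f x : open Omega -> C2_on Omega f -> Omega x ->
  \forall y \near x, twice_partial f y.
Proof. by move=> Oo f2 Ox; apply: filterS (near_open Oo Ox) => y /f2[]. Qed.

Lemma hessian_symmx Omega f x : open Omega -> C2_on Omega f -> Omega x ->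
  symmx (hessian f x).
Proof. by move=> Oo f2 Ox; apply: hessian_sym; exact: C2_near_twice_partial f2 Ox. Qed.

Lemma partial_sqnormB z i :
  partial i (fun x : 'rV[R]_n => sqnorm (x - z)) = fun x => 2 * x ord0 i + - (2 * z ord0 i).
Proof.
apply/funext => x.
have -> : (fun x : 'rV[R]_n => sqnorm (x - z)) =
    \sum_j (((fun x : 'rV[R]_n => x ord0 j) - cst (z ord0 j)) ^+ 2).
  apply/funext => y; rewrite fct_sumE; apply: eq_bigr => j _.
  by rewrite !mxE.
have D : is_derive x (evec R i)
    (\sum_j (((fun x : 'rV[R]_n => x ord0 j) - cst (z ord0 j)) ^+ 2))
    (\sum_j (2 * (x ord0 j - z ord0 j) * ((j == i)%:R - 0))).
  apply: is_derive_sum => j; have dj := @is_derive_coord R n x j i.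
  apply: is_derive_eq; rewrite -[_ *: _]/(_ * _) expr1 mulr_natl.
  by rewrite [LHS]/(_ * _).
have [_ E] := D; rewrite [LHS]E (bigD1 i)//= eqxx big1 => [|j /negbTE ->].
  by rewrite addr0 subr0 mulr1 mulrBr.
by rewrite subrr mulr0.
Qed.

Lemma polyfun_sqnormM d f z : polyfun d f -> polyfun d.+2 (fun x => sqnorm (x - z) * f x).
Proof.
move=> Pf.
have := @polyfun_sum R n d.+2 _ (index_enum 'I_n)
  (fun i x => x ord0 i * (x ord0 i * f x) + (- 2 * z ord0 i * (x ord0 i * f x) + z ord0 i ^+ 2 * f x)).
have -> : (fun x => sqnorm (x - z) * f x) = (fun x => \sum_i (x ord0 i * (x ord0 i * f x) +
   (- 2 * z ord0 i * (x ord0 i * f x) + z ord0 i ^+ 2 * f x))).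
  apply/funext => x; rewrite mulr_suml; apply: eq_bigr => i _; rewrite !mxE; ring.
apply => i; have Pxf := polyfun_coordM i Pf.
apply: (@polyfunD R n _ (fun x => x ord0 i * (x ord0 i * f x))); first exact: polyfun_coordM.
apply: (@polyfun_lin R n _ (- 2 * z ord0 i)); first exact: polyfunS.
by apply: polyfunZ; do 2 apply: polyfunS.
Qed.

Lemma polyfun_sqnormB z : polyfun 2 (fun x => sqnorm (x - z)).
Proof.
have := polyfun_sqnormM z (@polyfun_cst R n 0 1).
by congr polyfun; apply/funext => x; rewrite mulr1.
Qed.

Lemma hessian_sqnormB z x : hessian (fun x => sqnorm (x - z)) x = 2%:M.
Proof.
apply/matrixP => i j; rewrite !mxE partial_sqnormB.
have D : is_derive x (evec R j) (2 \*: (fun x : 'rV[R]_n => x ord0 i) + cst (- (2 * z ord0 i)))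
    (2 *: (i == j)%:R + 0).
  by have dj := @is_derive_coord R n x i j; apply: is_deriveD.
by have [_ E] := D; rewrite [LHS]E addr0 -[LHS]/(2 * (i == j)%:R) mulr_natr.
Qed.

End Hessians.

(** * Linear operators with constant coefficients *)

Section LinearOperator.
Context {R : realType} {n : nat}.
Variable A : 'M[R]_n.
Hypotheses (As : symmx A) (Ap : psd A).
Implicit Types (f g h : 'rV[R]_n -> R) (x y z : 'rV[R]_n) (Omega : set 'rV[R]_n).

Definition trop f x : R := \tr (A *m hessian f x).

Lemma trop_lin Omega (a : R) f g x : open Omega -> C2_on Omega f -> C2_on Omega g ->
  Omega x -> trop (fun x => a * f x + g x) x = a * trop f x + trop g x.
Proof.
move=> Oo f2 g2 Ox; have [_ hE] := C2_lin a Oo f2 g2.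
by rewrite /trop hE// mulmxDr mxtraceD -scalemxAr mxtraceZ.
Qed.

Lemma tropE f x : trop f x = \sum_i \sum_k A i k * partial i (partial k f) x.
Proof. by apply: eq_bigr => i _; rewrite mxE; apply: eq_bigr => k _; rewrite mxE. Qed.

Lemma trop_continuous Omega f x : C2_on Omega f -> Omega x -> {for x, continuous (trop f)}.
Proof.
move=> f2 Ox; rewrite (_ : trop f = fun y => \sum_i \sum_k A i k * partial i (partial k f) y).
  apply: continuous_at_sum => i; apply: continuous_at_sum => k.
  apply: (@continuousM _ _ (cst (A i k))); first exact: cst_continuous.
  by have [_ /(_ k)[_ [_ /(_ i)[]]]] := f2 _ Ox.
by apply/funext => y; exact: tropE.
Qed.

Lemma polyfun_trop d f : polyfun d.+2 f -> polyfun d (trop f).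
Proof.
move=> Pf; rewrite (_ : trop f = fun y => \sum_i \sum_k A i k * partial i (partial k f) y).
  apply: (@polyfun_sum R n d _ _ (fun i y => \sum_k A i k * partial i (partial k f) y)) => i.
  apply: (@polyfun_sum R n d _ _ (fun k y => A i k * partial i (partial k f) y)) => k.
  apply: polyfunZ; have [_ Pk _] := polyfun_partial k Pf.
  by have [] := polyfun_partial i Pk.
by apply/funext => y; exact: tropE.
Qed.

(** The Hessian at a local maximum is negative semidefinite, and its trace against the positive
    semidefinite [A] is nonpositive. *)
Lemma trop_local_max Omega f x : open Omega -> C2_on Omega f -> Omega x ->
  (\forall y \near x, f y <= f x) -> trop f x <= 0.
Proof.
move=> Oo f2 Ox fmax; apply: psd_nsd_trace_le0 => // a.
exact: second_derivative_test (C2_near_twice_partial Oo f2 Ox) fmax.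
Qed.

Lemma near_eball z (c : R) x : sqnorm (x - z) < c -> \forall y \near x, sqnorm (y - z) < c.
Proof. by move=> xc; move: (@continuous_sqnormB R n z x) => /cvgr_lt; apply. Qed.

Lemma max_principle Omega f z (c m : R) : open Omega -> C2_on Omega f ->
  (forall x, sqnorm (x - z) <= c -> Omega x) ->
  (forall x, sqnorm (x - z) < c -> 0 < trop f x) ->
  (forall x, sqnorm (x - z) = c -> f x <= m) ->
  forall x, sqnorm (x - z) <= c -> f x <= m.
Proof.
move=> Oo f2 BO Lf fm x xc.
pose B := [set x | sqnorm (x - z) <= c].
have B0 : B !=set0 by exists x.
have [|p] := @EVT_max_rV R n f B B0 (@compact_closed_eball R n z c).
  by apply: continuous_in_subspaceT => y /set_mem /BO /f2[].
rewrite inE => pc pmax; apply: le_trans (pmax x _) _; first by rewrite inE.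
have [pe|pe] := eqVneq (sqnorm (p - z)) c; first exact: fm.
have {}pe : sqnorm (p - z) < c by rewrite lt_neqAle pe.
have := trop_local_max Oo f2 (BO _ pc); rewrite leNgt Lf// => h.
suff /h : \forall y \near p, f y <= f p by [].
by apply: filterS (near_eball pe) => y /ltW yc; apply: pmax; rewrite inE.
Qed.

Lemma trop_sqnormB z x : trop (fun x => sqnorm (x - z)) x = 2 * \tr A.
Proof. by rewrite /trop hessian_sqnormB mul_mx_scalar mxtraceZ. Qed.

Hypothesis At : 0 < \tr A.

(** Adding [e / c * sqnorm (x - z)] makes the operator strictly positive and the boundary value [e];
    the maximum principle applies, and [e] is arbitrary. *)
Lemma harmonic_le0 d q z (c : R) : 0 < c -> polyfun d q ->
  (forall x, trop q x = 0) -> (forall x, sqnorm (x - z) = c -> q x = 0) ->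
  forall x, sqnorm (x - z) <= c -> q x <= 0.
Proof.
move=> c0 Pq Lq q0 x xc; apply/ler_addgt0Pr => e e0; rewrite add0r.
pose f x := e / c * sqnorm (x - z) + q x.
have ec : 0 < e / c by rewrite divr_gt0.
have q2 := @polyfun_C2 R n d q setT Pq.
have s2 := @polyfun_C2 R n _ _ setT (polyfun_sqnormB z).
have [f2 fH] := C2_lin (e / c) openT s2 q2.
have : f x <= e.
  apply: (@max_principle setT f z c e openT f2) => // [y _|y yc].
    rewrite (trop_lin _ openT s2 q2)// Lq addr0 trop_sqnormB.
    by rewrite mulr_gt0// mulr_gt0.
  by rewrite /f yc q0// addr0 divfK// gt_eqF.
apply: le_trans; rewrite /f lerDr mulr_ge0// ?sqnorm_ge0//.
exact: ltW.
Qed.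

(* [h = g + (c - |x - z|^2) p]: the map [p |-> trop ((c - |x - z|^2) p)] preserves the
   degree and is injective by the maximum principle, hence onto. *)
Lemma polynomial_dirichlet d g z (c k : R) : 0 < c -> polyfun d g ->
  exists h, [/\ polyfun d.+2 h, forall x, trop h x = k &
    forall x, sqnorm (x - z) = c -> h x = g x].
Proof.
move=> c0 Pg; pose rho x := c - sqnorm (x - z).
have Prho p : polyfun d p -> polyfun d.+2 (fun x => rho x * p x).
  move=> Pp; have := polyfun_lin (-1) (polyfun_sqnormM z Pp) (polyfunS (polyfunS (polyfunZ c Pp))).
  by congr polyfun; apply/funext => x; rewrite /rho; ring.
pose T p := trop (fun x => rho x * p x).
have C2T f e : polyfun e f -> C2_on setT f by exact: polyfun_C2.
have [I [m span]] := @polyfun_span R n d.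
have surj q : polyfun d q -> exists2 p, polyfun d p & T p = q.
  apply: (fin_span_inj_surj span) => [|a f1 f2 P1 P2|f Pf|a f1 f2 P1 P2|p Pp Tp].
  - exact: polyfun_cst.
  - exact: polyfun_lin.
  - by apply: polyfun_trop; exact: Prho.
  - apply/funext => x; rewrite -[RHS]/(a * T f1 x + T f2 x).
    have L := trop_lin a openT (C2T _ _ (Prho _ P1)) (C2T _ _ (Prho _ P2)) (Logic.I : setT x).
    apply: etrans _ L; congr (trop _ x); apply/funext => y.
    by rewrite -[(a *: f1 + f2) y]/(a * f1 y + f2 y); ring.
  - have q0 x : sqnorm (x - z) <= c -> rho x * p x = 0.
      move=> xc; apply/eqP; rewrite eq_le; apply/andP; split.
        apply: (harmonic_le0 c0 (Prho _ Pp)) xc => y; first exact: (congr1 (fun F => F y) Tp).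
        by move=> yc; rewrite /rho yc subrr mul0r.
      (* The opposite function is put in the shape [a * f + g] required by [trop_lin]. *)
      have qE : forall y, - (rho y * p y) = - 2 * (rho y * p y) + rho y * p y by move=> y; ring.
      rewrite -oppr_le0 qE.
      apply: (harmonic_le0 c0 (polyfun_lin (- 2) (Prho _ Pp) (Prho _ Pp))) xc => y.
        rewrite (trop_lin (- 2) openT (C2T _ _ (Prho _ Pp)) (C2T _ _ (Prho _ Pp)))//.
        by rewrite -[trop _ y]/(T p y) Tp mulr0 addr0.
      by move=> yc; rewrite /rho yc subrr mul0r mulr0 addr0.
    (* Inside the ball [rho] is positive, so [p] vanishes there and hence everywhere. *)
    apply/funext; apply: (polyfun_identity c0 Pp) => x xc.
    have := q0 x (ltW xc) => /eqP; rewrite mulf_eq0 => /orP[|/eqP//].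
    by rewrite subr_eq0 => /eqP E; rewrite E ltxx in xc.
(* The correction [rho * p] must contribute [k - trop A g], and it vanishes on the sphere. *)
have [p Pp TpE] : exists2 p, polyfun d p & T p = (fun x => - 1 * trop g x + k).
  apply: surj; apply: polyfun_lin; last exact: polyfun_cst.
  by apply: polyfun_trop; do 2 apply: polyfunS.
have Pq := Prho _ Pp; have Pg2 := polyfunS (polyfunS Pg).
exists (fun x => 1 * (rho x * p x) + g x); split.
- exact: polyfun_lin.
- move=> x; rewrite (trop_lin 1 openT (C2T _ _ Pq) (C2T _ _ Pg))// mul1r.
  by rewrite -[trop _ x]/(T p x) TpE; ring.
- by move=> x xc; rewrite /rho xc subrr mul0r mulr0 add0r.
Qed.
End LinearOperator.

(** * Polynomial approximation *)

Section RandomWalk.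
Context {R : realType} {n : nat} {I : finType}.
Variables (wt : I -> 'rV[R]_n -> R) (step : I -> 'rV[R]_n) (h : R).
Implicit Types (f g : 'rV[R]_n -> R) (s x y z w : 'rV[R]_n).

(* Expectation of [f] after [k] steps of length [h] from [s], the step [o] being taken with
   probability [wt o x]: a Bernstein polynomial in [x] when the weights are affine. *)
Fixpoint walk k f s x : R :=
  if k is k'.+1 then \sum_o wt o x * walk k' f (s + h *: step o) x else f s.

Lemma walkN k f s x : walk k (fun y => - f y) s x = - walk k f s x.
Proof.
elim: k s => //= k IH s; rewrite -sumrN; apply: eq_bigr => o _.
by rewrite IH mulrN.
Qed.

Lemma polyfun_walk k f s :
  (forall o d g, polyfun d g -> polyfun d.+1 (fun x => wt o x * g x)) ->
  polyfun k (walk k f s).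
Proof.
move=> wtP; elim: k s => [|k IH] s; first by exists (f s).
by apply: (@polyfun_sum R n k.+1 _ _ (fun o x => wt o x * walk k f (s + h *: step o) x)) => o;
  exact: wtP.
Qed.

(** A second moment estimate. Each step has mean [h *: w], so after [k] steps the mean position
    relative to [x] is [s - x + (k%:R * h) *: w], and each step adds at most [h ^+ 2 * V] of
    variance. *)
Lemma walk_le k f s x w (a C V : R) : 0 <= C ->
  (forall o, 0 <= wt o x) -> \sum_o wt o x = 1 ->
  (forall i, \sum_o wt o x * step o ord0 i = w ord0 i) ->
  (forall o, sqnorm (step o) <= V) ->
  (forall y, f y <= a + C * sqnorm (y - x)) ->
  walk k f s x <= a + C * (sqnorm (s - x + (k%:R * h) *: w) + k%:R * h ^+ 2 * V).
Proof.
move=> C0 wt0 wt1 wtw stepV fle; elim: k s => [|k IH] s.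
  by rewrite !mul0r scale0r !addr0 /=; exact: fle.
rewrite /=; pose t := s - x + (k%:R * h) *: w.
have dotw : \sum_o wt o x * dotrv t (step o) = dotrv t w.
  rewrite /dotrv; under eq_bigr => o _ do rewrite mulr_sumr.
  rewrite exchange_big; apply: eq_bigr => i _ /=; rewrite -wtw mulr_sumr.
  by apply: eq_bigr => o _; ring.
have E : s - x + (k.+1%:R * h) *: w = t + h *: w.
  by rewrite /t -[RHS]addrA -scalerDl -[k.+1]addn1 natrD mulrDl mul1r.
rewrite E sqnormD.
apply: (@le_trans _ _ (\sum_o wt o x * (a + C * (sqnorm t + k%:R * h ^+ 2 * V) +
    C * h ^+ 2 * V + 2 * C * h * dotrv t (step o)))).
  apply: ler_sum => o _; apply: ler_wpM2l => //; apply: le_trans (IH _) _.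
  have -> : s + h *: step o - x + (k%:R * h) *: w = t + h *: step o.
    by rewrite /t [s + _ - x]addrAC [RHS]addrAC.
  rewrite sqnormD.
  have : C * h ^+ 2 * sqnorm (step o) <= C * h ^+ 2 * V.
    by apply: ler_wpM2l (stepV o); rewrite mulr_ge0// sqr_ge0.
  by move: (sqnorm t) (dotrv t _) (sqnorm _) => t1 t2 t3; lra.
under eq_bigr => o _ do rewrite mulrDr.
rewrite big_split/= -mulr_suml wt1 mul1r.
have -> : \sum_o wt o x * (2 * C * h * dotrv t (step o)) = 2 * C * h * dotrv t w.
  by rewrite -dotw mulr_sumr; apply: eq_bigr => o _; ring.
(* The second moment of a step bounds its variance: the square of the mean is discarded. *)
have := mulr_ge0 (mulr_ge0 C0 (sqr_ge0 h)) (sqnorm_ge0 w).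
rewrite -[k.+1]addn1 natrD.
by move: (sqnorm t) (dotrv t _) (sqnorm _) => t1 t2 t3; lra.
Qed.
End RandomWalk.

(** * Uniform approximation of continuous functions on balls by polynomials *)

Section PolynomialApproximation.
Context {R : realType} {n : nat}.
Implicit Types (f g : 'rV[R]_n -> R) (s x y z w : 'rV[R]_n).

Lemma coord_le_sqnorm x (r : R) i : 0 <= r -> sqnorm x <= r ^+ 2 -> `|x ord0 i| <= r.
Proof.
move=> r0 xr; rewrite -(@ler_pXn2r _ 2)// ?nnegrE//.
apply: le_trans xr; apply: le_trans (norm_le_sqnorm x).
by rewrite lerXn2r ?nnegrE// coord_le_norm.
Qed.

(** A walk of [N.+1] steps from [z] has mean endpoint [x] and variance at most [V / N.+1%:R]. One
    [e] comes from the assumed bound on [f], the other from this variance. *)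
Lemma polyfun_approx f z (r e C : R) : (0 < n)%N -> 0 < r -> 0 < e -> 0 <= C ->
  (forall x, sqnorm (x - z) <= r ^+ 2 ->
     forall y, `|f y - f x| <= e + C * sqnorm (y - x)) ->
  exists d p, polyfun d p /\
    forall x, sqnorm (x - z) <= r ^+ 2 -> `|p x - f x| <= 2 * e.
Proof.
move=> n0 r0 e0 C0 fle.
have nR : 0 < n%:R :> R by rewrite ltr0n.
pose sg (b : bool) : R := if b then 1 else -1.
(* A coordinate is drawn uniformly, then a sign biased by [(x_i - z_i) / r], which lies between -1
   and 1 in the ball. Steps of length [n%:R * r] give the mean [x - z]. *)
pose wt (o : 'I_n * bool) (x : 'rV[R]_n) : R :=
  (1 + sg o.2 * ((x ord0 o.1 - z ord0 o.1) / r)) / (2 * n%:R).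
pose step (o : 'I_n * bool) : 'rV[R]_n := (sg o.2 * n%:R * r) *: evec R o.1.
pose V := (n%:R * r) ^+ 2.
have [N NV] : exists N : nat, C * V / e <= N.+1%:R.
  by exists (Num.truncn (C * V / e)); apply/ltW/truncnS_gt.
pose h : R := N.+1%:R^-1.
have wtP o d g : polyfun d g -> polyfun d.+1 (fun x => wt o x * g x).
  move=> Pg; have := polyfun_lin (sg o.2 / r / (2 * n%:R)) (polyfun_coordM o.1 Pg)
    (polyfunS (polyfunZ ((1 - sg o.2 * z ord0 o.1 / r) / (2 * n%:R)) Pg)).
  by congr polyfun; apply/funext => x; rewrite /wt; ring.
exists N.+1, (walk wt step h N.+1 f z); split; first exact: polyfun_walk.
move=> x xr.
have wt0 o : 0 <= wt o x.
  rewrite divr_ge0 ?mulr_ge0 ?ler0n//.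
  have : `|(x - z) ord0 o.1 / r| <= 1.
    by rewrite normrM normfV (gtr0_norm r0) ler_pdivrMr// mul1r coord_le_sqnorm// ltW.
  rewrite !mxE ler_norml /sg; move: (_ / r) => t /andP[t1 t2].
  by case: o.2 => /=; lra.
have wt1 : \sum_o wt o x = 1.
  rewrite -(pair_bigA _ (fun i b => wt (i, b) x))/=.
  under eq_bigr => i _ do rewrite big_bool.
  transitivity (\sum_(i < n) (n%:R^-1 : R)).
    by apply: eq_bigr => i _; rewrite /wt/=; field; rewrite !gt_eqF.
  by rewrite sumr_const card_ord -[LHS]mulr_natr mulVf// gt_eqF.
have wtw i : \sum_o wt o x * step o ord0 i = (x - z) ord0 i.
  rewrite -(pair_bigA _ (fun i' b => wt (i', b) x * step (i', b) ord0 i))/=.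
  under eq_bigr => i' _ do rewrite big_bool.
  rewrite (bigD1 i)//= big1 => [|j /negbTE ji]; last first.
    by rewrite !mxE [i == j]eq_sym ji/= !mulr0 addr0.
  by rewrite !mxE !eqxx /wt/=; field; rewrite !gt_eqF.
have stepV o : sqnorm (step o) <= V.
  rewrite /sqnorm (bigD1 o.1)//= big1 => [|j /negbTE ji].
    by rewrite !mxE !eqxx mulr1 addr0 /V /sg; case: o.2 => /=; rewrite ?mulN1r ?mul1r ?mulNr ?sqrrN.
  by rewrite !mxE ji/= mulr0 expr0n.
have bound g a : (forall y, g y <= a + C * sqnorm (y - x)) ->
    walk wt step h N.+1 g z x <= a + e.
  move=> gle; apply: le_trans (walk_le _ _ _ C0 wt0 wt1 wtw stepV gle) _.
  have -> : z - x + (N.+1%:R * h) *: (x - z) = 0.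
    by rewrite /h mulfV// scale1r -opprB addNr.
  have -> : sqnorm (0 : 'rV[R]_n) = 0 by apply: big1 => i _; rewrite mxE expr0n.
  have -> : N.+1%:R * h ^+ 2 = h by rewrite /h expr2 mulrA mulfV// mul1r.
  by rewrite lerD2l add0r /h mulrCA ler_pdivrMl// -ler_pdivrMr.
have up : walk wt step h N.+1 f z x <= f x + e + e.
  by apply: bound => y; have := fle x xr y; rewrite ler_norml => /andP[_ ?]; lra.
have lo : walk wt step h N.+1 (fun y => - f y) z x <= - f x + e + e.
  by apply: bound => y; have := fle x xr y; rewrite ler_norml => /andP[? _]; lra.
rewrite walkN in lo.
by rewrite ler_norml; apply/andP; split; lra.
Qed.

(** Here [y] may lie outside [K], as [f] is continuous at the points of [K] in the whole space. *)
Lemma compact_unif_continuous_at f (K : set 'rV[R]_n) (e : R) : compact K -> 0 < e ->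
  (forall x, K x -> {for x, continuous f}) ->
  exists2 d, 0 < d & forall x, K x -> forall y, `|y - x| < d -> `|f y - f x| <= e.
Proof.
move=> /compact_near_coveringP Kc e0 fc.
pose P (d : R) x := forall y, `|y - x| < d -> `|f y - f x| <= e.
have : \forall d \near (0 : R)^'+, K `<=` P d.
  apply: Kc => x Kx.
  have : \forall y \near x, `|f x - f y| <= e / 2.
    by move: (fc _ Kx) => /cvgrPdist_le; apply; rewrite divr_gt0.
  move=> /near_normP[d d0 fd].
  exists ([set y | `|y - x| < d / 2], [set t | t < d / 2]).
    split=> /=; last by apply: nbhs_right_lt; rewrite divr_gt0.
    apply: (near_normP x (fun y => `|y - x| < d / 2)).2.
    by exists (d / 2) => //; rewrite divr_gt0.
  move=> [x' t] [/= xx' td] y yx'.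
  rewrite (le_trans (ler_distD (f x) _ _))// [leRHS]splitr lerD//.
    rewrite distrC; apply: fd; rewrite (le_lt_trans (ler_distD x' _ _))//.
    by rewrite [ltRHS]splitr ltrD// (lt_trans yx').
  by apply: fd; rewrite (lt_trans xx')// ltr_pdivrMr// ltr_pMr// ltr1n.
move=> H; have [d [d0 dP]] : exists d : R, 0 < d /\ K `<=` P d.
  near (0 : R)^'+ => d; exists d; split; first by [].
  by near: d.
by exists d => // x /dP.
Unshelve. all: end_near. Qed.

(** The walk can leave the ball, so [u] is replaced by 0 outside a larger one to become bounded by
    some [M]. Uniform continuity handles [|y - x| < d]; at larger distances [2 * M] is at most
    [2 * M / d ^+ 2 * sqnorm (y - x)]. *)
Lemma continuous_polyfun_approx u z (r r' e : R) :
  (0 < n)%N -> 0 < r -> r ^+ 2 < r' -> 0 < e ->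
  (forall x, sqnorm (x - z) <= r' -> {for x, continuous u}) ->
  exists d p, polyfun d p /\
    forall x, sqnorm (x - z) <= r ^+ 2 -> `|p x - u x| <= e.
Proof.
move=> n0 r0 rr' e0 uc.
pose B' := [set x | sqnorm (x - z) <= r'].
pose f x := if sqnorm (x - z) <= r' then u x else 0.
have fu x : sqnorm (x - z) <= r ^+ 2 -> \forall y \near x, u y = f y.
  move=> xr; apply: filterS (near_eball (le_lt_trans xr rr')) => y /ltW yr.
  by rewrite /f yr.
have fc x : sqnorm (x - z) <= r ^+ 2 -> {for x, continuous f}.
  move=> xr; apply: near_eq_continuous_at (fu x xr) _.
  by apply: uc; rewrite (le_trans xr)// ltW.
have z0 : sqnorm (z - z) = 0 by rewrite subrr; apply: big1 => i _; rewrite mxE expr0n.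
have B'0 : B' !=set0 by exists z; rewrite /B' /= z0 (le_trans _ (ltW rr'))// sqr_ge0.
have [|p _ pmax] := @EVT_max_rV R n (fun x => `|u x|) B' B'0 (@compact_closed_eball R n z r').
  apply: continuous_in_subspaceT => y /set_mem /uc uy.
  exact: (@cvg_norm _ _ _ _ _ u (u y) uy).
pose M := `|u p|.
have fM y : `|f y| <= M.
  rewrite /f; case: ifPn => [yB|_]; last by rewrite normr0 /M normr_ge0.
  by apply: pmax; rewrite inE; exact: yB.
have [|d d0 fd] := compact_unif_continuous_at (@compact_closed_eball R n z (r ^+ 2)) _ fc (e := e / 2).
  by rewrite divr_gt0.
have M0 : 0 <= M by exact: normr_ge0.
have C0 : 0 <= 2 * M / d ^+ 2 by apply: divr_ge0; [exact: mulr_ge0|exact: sqr_ge0].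
have [|||k [q [Pq qf]]] := @polyfun_approx f z r (e / 2) (2 * M / d ^+ 2) n0 r0.
- by rewrite divr_gt0.
- exact: C0.
- move=> x xr y; have [yd|yd] := ltP `|y - x| d.
    by rewrite (le_trans (fd _ xr _ yd))// lerDl; exact: mulr_ge0 C0 (sqnorm_ge0 _).
  have dS : d ^+ 2 <= sqnorm (y - x).
    by apply: le_trans (norm_le_sqnorm _); rewrite lerXn2r ?nnegrE// ltW.
  rewrite (le_trans (ler_normB _ _))//.
  apply: (@le_trans _ _ (2 * M)).
    by rewrite mulr_natl mulr2n lerD.
  apply: (@le_trans _ _ (2 * M / d ^+ 2 * sqnorm (y - x))).
    by rewrite mulrAC ler_pdivlMr ?exprn_gt0//; apply: ler_wpM2l => //; exact: mulr_ge0.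
  by rewrite lerDr ltW// divr_gt0.
exists k, q; split => // x xr.
have := qf x xr; rewrite mulrC divfK//.
by rewrite /f (le_trans xr (ltW rr')).
Qed.

End PolynomialApproximation.

(** * Viscosity subsolutions *)

Section ViscosityComparison.
Context {R : realType} {n : nat}.
Implicit Types (u h : 'rV[R]_n -> R) (x y z : 'rV[R]_n) (Omega : set 'rV[R]_n).

Lemma open_B1 : open (@B1 R n).
Proof.
have -> : @B1 R n = (fun x => sqnorm (x - 0)) @^-1` [set y | y < 1].
  apply/funext => x; rewrite /B1 /= subr0 -[enorm x]/(Num.sqrt (sqnorm x)).
  by rewrite -{1}(sqrtr1 R) ltr_sqrt.
by apply: open_comp => [x _|]; [exact: continuous_sqnormB|exact: open_lt].
Qed.

Lemma small_eball (d : R) : 0 < d ->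
  exists r b, [/\ 0 < r, r ^+ 2 < b & forall x, sqnorm x <= b -> `|x| < d].
Proof.
move=> d0; exists (d / 4), ((d / 2) ^+ 2); split; [lra|nra|move=> x xb].
apply: (@le_lt_trans _ _ (d / 2)); last by lra.
rewrite -(@ler_pXn2r _ 2)// ?nnegrE//; last by lra.
exact: le_trans (norm_le_sqnorm _) xb.
Qed.

Lemma within_open_continuous Omega u x : open Omega -> {within Omega, continuous u} ->
  Omega x -> {for x, continuous u}.
Proof. by move=> Oo; rewrite continuous_open_subspace// => uc Ox; apply: uc; rewrite inE. Qed.

(** The polynomial [h] is itself the test function: at an interior maximum of [u - h] the Hessian of
    [h] would satisfy [0 <= F], whence [c <= k]. *)
Lemma visc_subsol_le (F : 'M[R]_n -> R) (A : 'M[R]_n) (c k : R) Omega u h d z (b : R) :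
  open Omega -> visc_subsol F Omega u ->
  (forall M, symmx M -> 0 <= F M -> c <= \tr (A *m M)) ->
  polyfun d h -> (forall x, trop A h x = k) -> k < c ->
  (forall x, sqnorm (x - z) <= b -> Omega x) ->
  (forall x, sqnorm (x - z) = b -> u x <= h x) ->
  forall x, sqnorm (x - z) <= b -> u x <= h x.
Proof.
move=> Oo [uc usub] FA Ph hk kc BO ule x xb.
pose B := [set x | sqnorm (x - z) <= b].
have h2 : C2_on Omega h by exact: polyfun_C2 Ph.
have B0 : B !=set0 by exists x.
have [|p] := @EVT_max_rV R n (u - h) B B0 (@compact_closed_eball R n z b).
  apply: continuous_in_subspaceT => y /set_mem /BO Oy; apply: continuousB.
    exact: within_open_continuous uc Oy.
  exact: (polyfun_continuous Ph).
rewrite inE => pb pmax.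
suff : (u - h) p <= 0.
  by move=> up; rewrite -subr_le0; apply: le_trans up; apply: (pmax x); rewrite inE.
have [pe|pe] := eqVneq (sqnorm (p - z)) b; first by rewrite subr_le0; exact: ule.
have {}pe : sqnorm (p - z) < b by rewrite lt_neqAle pe.
have Hs := hessian_symmx Oo h2 (BO _ pb).
have := FA _ Hs; rewrite -[\tr _]/(trop A h p) hk [c <= k]leNgt kc => fals.
suff /fals : 0 <= F (hessian h p) by [].
apply: usub => //; first exact: BO.
apply: filterS (near_eball pe) => y /ltW yb.
by apply: (pmax y); rewrite inE.
Qed.

(* Up to [e], a viscosity subsolution is dominated in a ball by a polynomial with
   [trop A h = k] that is close to it on the sphere. *)
Lemma visc_subsol_majorant (F : 'M[R]_n -> R) (A : 'M[R]_n) (c k : R) Omega u z (r b e : R) :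
  (0 < n)%N -> symmx A -> psd A -> 0 < \tr A ->
  open Omega -> visc_subsol F Omega u ->
  (forall M, symmx M -> 0 <= F M -> c <= \tr (A *m M)) ->
  k < c -> 0 < r -> r ^+ 2 < b -> 0 < e ->
  (forall x, sqnorm (x - z) <= b -> Omega x) ->
  exists d h, [/\ polyfun d h, forall x, trop A h x = k,
    forall x, sqnorm (x - z) <= r ^+ 2 -> u x <= h x &
    forall x, sqnorm (x - z) = r ^+ 2 -> h x <= u x + 2 * e].
Proof.
move=> n0 As Ap At Oo usub FA kc r0 rb e0 BO.
have uc x : sqnorm (x - z) <= b -> {for x, continuous u}.
  by move=> /BO; apply: within_open_continuous => //; exact: usub.1.
have [d [p [Pp pu]]] := continuous_polyfun_approx n0 r0 rb e0 uc.
have r20 : 0 < r ^+ 2 by rewrite exprn_gt0.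
(* Since [p] is within [e] of [u], the boundary data [p + e] lie between [u] and [u + 2 * e]. *)
have [h [Ph hk hp]] := polynomial_dirichlet As Ap At z k r20 (polyfunD Pp (polyfun_cst d e)).
exists d.+2, h; split => // [x xr|x xr].
  apply: (visc_subsol_le Oo usub FA Ph hk kc _ _ xr) => y yr.
    by apply: BO; rewrite (le_trans yr)// ltW.
  by rewrite hp//; have := pu y; rewrite yr lexx ler_norml => /(_ isT)/andP[? ?]; rewrite /cst; lra.
rewrite hp//; have := pu x; rewrite xr lexx ler_norml => /(_ isT)/andP[? ?].
by rewrite /cst; lra.
Qed.

(* Otherwise unification unfolds [trop] down to limits of difference quotients. *)
#[local] Opaque trop.

(** With [psi] equal to [phi + eta * |x - z|^2], the function [f] below is
    [theta * hu + (1 - theta) * hv - psi], written so that [C2_lin] applies. Its operator value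
    [k - trop A psi] is positive near [z], yet its value at [z] exceeds its bound on the sphere. *)
Lemma visc_subsol_convex_touch (F : 'M[R]_n -> R) (A : 'M[R]_n) (c : R) Omega
    u v phi (theta : R) z :
  (0 < n)%N -> symmx A -> psd A -> 0 < \tr A ->
  open Omega -> visc_subsol F Omega u -> visc_subsol F Omega v ->
  (forall M, symmx M -> 0 <= F M -> c <= \tr (A *m M)) ->
  0 < theta < 1 -> C2_on Omega phi -> Omega z ->
  (\forall x \near z, theta * u x + (1 - theta) * v x - phi x <=
                      theta * u z + (1 - theta) * v z - phi z) ->
  c <= trop A phi z.
Proof.
move=> n0 As Ap At Oo usub vsub FA /andP[t0 t1] phi2 Oz touch.
have t1' : 0 <= 1 - theta by rewrite subr_ge0 ltW.
have sphere (a b ha hb p w0 s e : R) : ha <= a + 2 * e -> hb <= b + 2 * e ->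
    theta * a + (1 - theta) * b - p <= w0 ->
    - 1 * (s + p) + (theta * (- 1 * hb + ha) + hb) <= w0 + 2 * e - s.
  by move=> /(ler_wpM2l (ltW t0)) ? /(ler_wpM2l t1') ? ?; lra.
have center (a b ha hb p s : R) : 0 < s -> a <= ha -> b <= hb ->
    ~~ (- 1 * p + (theta * (- 1 * hb + ha) + hb) <=
        theta * a + (1 - theta) * b - p + 2 * (s / 4) - s).
  by move=> s0 /(ler_wpM2l (ltW t0)) ? /(ler_wpM2l t1') ?; rewrite -ltNge; lra.
rewrite leNgt; apply/negP => Lphi.
pose g := c - trop A phi z; have g0 : 0 < g by rewrite subr_gt0.
(* The quadratic term contributes [eta * (2 * \tr A) = g / 4], so [trop A psi z = c - 3 * g / 4],
   which is below [k = c - g / 2]. *)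
pose eta := g / (8 * \tr A).
have eta0 : 0 < eta by rewrite divr_gt0// mulr_gt0.
have s2 := @polyfun_C2 R n _ _ Omega (polyfun_sqnormB z).
have [psi2 _] := C2_lin eta Oo s2 phi2.
set psi := (fun x => eta * sqnorm (x - z) + phi x) in psi2.
pose k := c - g / 2.
have kc : k < c by rewrite /k; lra.
have Lpsi : trop A psi z < k.
  rewrite (trop_lin _ _ Oo s2 phi2)// trop_sqnormB.
  have -> : eta * (2 * \tr A) = g / 4 by rewrite /eta; field; rewrite gt_eqF.
  by rewrite /k /g; lra.
have : \forall x \near z, [/\ Omega x, trop A psi x < k &
    theta * u x + (1 - theta) * v x - phi x <= theta * u z + (1 - theta) * v z - phi z].
  near=> x; split; near: x => //; first exact: near_open.
  by move: (trop_continuous (A := A) psi2 Oz) => /cvgr_lt; apply.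
move=> /near_normP[d d0 near_z].
have [r [b [r0 rb bd]]] := small_eball d0.
have near_b x : sqnorm (x - z) <= b -> [/\ Omega x, trop A psi x < k &
    theta * u x + (1 - theta) * v x - phi x <= theta * u z + (1 - theta) * v z - phi z].
  by move=> xb; apply: near_z; exact: bd.
have BO x : sqnorm (x - z) <= b -> Omega x by move=> /near_b[].
have rB x : sqnorm (x - z) <= r ^+ 2 -> sqnorm (x - z) <= b.
  by move=> /le_trans; apply; exact: ltW.
(* The error [2 * e] on the sphere is then half of the gain [eta * r ^+ 2] there. *)
pose e := eta * r ^+ 2 / 4.
have r20 : 0 < r ^+ 2 by rewrite exprn_gt0.
have e0 : 0 < e by rewrite divr_gt0// mulr_gt0.
have [du [hu [Pu Lu ule hule]]] := visc_subsol_majorant n0 As Ap At Oo usub FA kc r0 rb e0 BO.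
have [dv [hv [Pv Lv vle hvle]]] := visc_subsol_majorant n0 As Ap At Oo vsub FA kc r0 rb e0 BO.
have hu2 := @polyfun_C2 R n _ _ Omega Pu; have hv2 := @polyfun_C2 R n _ _ Omega Pv.
have [d2 _] := C2_lin (- 1) Oo hv2 hu2.
have [q2 _] := C2_lin theta Oo d2 hv2.
have [f2 _] := C2_lin (- 1) Oo psi2 q2.
set f := (fun x => - 1 * psi x + _) in f2.
have z0 : sqnorm (z - z) = 0 by rewrite subrr; apply: big1 => i _; rewrite mxE expr0n.
have := @max_principle R n A As Ap Omega f z (r ^+ 2)
  (theta * u z + (1 - theta) * v z - phi z + 2 * e - eta * r ^+ 2) Oo f2.
move=> /(_ _ _ _ z); rewrite z0 => mp.
have : f z <= theta * u z + (1 - theta) * v z - phi z + 2 * e - eta * r ^+ 2.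
  apply: mp => [x /rB/BO//|x /ltW/rB/near_b[Ox Lx _]|x xr|]; last exact: ltW.
    rewrite (trop_lin _ _ Oo psi2 q2)// (trop_lin _ _ Oo d2 hv2)// (trop_lin _ _ Oo hv2 hu2)//.
    by rewrite Lu Lv !mulN1r addNr mulr0 add0r addrC subr_gt0.
  have xr' : sqnorm (x - z) <= r ^+ 2 by rewrite xr.
  have [_ _ tx] := near_b x (rB x xr').
  by rewrite /f /psi xr; exact: sphere (hule x xr) (hvle x xr) tx.
have zr : sqnorm (z - z) <= r ^+ 2 by rewrite z0 ltW.
rewrite /f /psi z0 mulr0 add0r; apply/negP; apply: center (ule z zr) (vle z zr).
exact: mulr_gt0.
Unshelve. all: end_near. Qed.

End ViscosityComparison.

Theorem theorem4p6 (R : realType) (n : nat) (F : 'M[R]_n -> R) (lam Lam : R)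
  (u v : 'rV[R]_n -> R) (theta : R) :
  unif_elliptic F lam Lam ->
  {within [set M : 'M[R]_n | symmx M], continuous F} ->
  quasiconcave F ->
  visc_subsol F (@B1 R n) u -> visc_subsol F (@B1 R n) v ->
  0 < theta < 1 ->
  visc_subsol F (@B1 R n) (fun x => theta * u x + (1 - theta) * v x).
Proof.
move=> Fell Fc Fq usub vsub t01; have B1o := @open_B1 R n.
split.
  rewrite continuous_open_subspace// => x; rewrite inE => Bx.
  have uc := within_open_continuous B1o usub.1 Bx.
  have vc := within_open_continuous B1o vsub.1 Bx.
  apply: (@continuousD _ _ _ (fun x => theta * u x) (fun x => (1 - theta) * v x)).
    by apply: (@continuousM _ _ (cst theta)) => //; exact: cst_continuous.
  by apply: (@continuousM _ _ (cst (1 - theta))) => //; exact: cst_continuous.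
move=> phi z phi2 Bz touch.
(* Separation with positive trace requires [0 < n]. For [n = 0] the space is a single point, so
   [phi] touches [u] itself at [z]. *)
have [n0|n0] := posnP n.
  have all_eq (x y : 'rV[R]_n) : x = y.
    by apply/rowP => i; have := ltn_ord i; rewrite [X in (_ < X)%N]n0.
  by apply: usub.2 => //; apply/near_normP; exists 1 => // x _; rewrite (all_eq x z).
rewrite leNgt; apply/negP => Fphi.
have Hs := hessian_symmx B1o phi2 Bz.
have [A [c [As Ap At FA]]] := elliptic_separation n0 Fell Fc Fq Hs Fphi.
rewrite ltNge => /negP; apply.
exact: visc_subsol_convex_touch n0 As Ap At B1o usub vsub FA t01 phi2 Bz touch.
Qed.
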